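(* Let $(d_n)_{n\ge 1}$ be the real sequence of coefficients in the expansion $$\left(1+\frac{1}{m}\right)^{m}=e\left(1-\sum_{k=1}^{\infty}\frac{d_k}{\left(m+\frac{11}{12}\right)^{k}}\right),\qquad m=1,2,3,\ldots,$$ and let $$g(s)=\frac{1}{\pi}\,s^{s}(1-s)^{1-s}\sin(\pi s),\qquad 0<s<1.$$ Then $$d_n=\frac{(-1)^n}{12^{\,n-1}}\left(-\frac12+\frac1e\int_0^1\frac{(12s-11)^{n-1}-1}{s-1}\,g(s)\,ds\right),\qquad n=2,3,\ldots.$$
   Context: $e$ is the base of the natural logarithm. The sequence $(d_n)$ is the sequence of coefficients of the expansion of $(1+1/m)^m$ in negative powers of $m+\frac{11}{12}$ displayed in the claim; its first terms are $d_1=\frac12$, $d_2=0$, $d_3=\frac{5}{288}$, $d_4=\frac{139}{17280}$, $d_5=\frac{119}{23040}$. *)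

(* Defs.v *)
From Stdlib Require Import Reals.
From Coquelicot Require Import Coquelicot.
Open Scope R_scope.

(* [d] is indexed from 1; [d 0] is never used.  The points [1 / (m + 11/12)]
   accumulate at 0, so convergence and equality at all positive integers [m]
   determine [d n] for every [n >= 1]. *)
Definition expansion_term (d : nat -> R) (m k : nat) : R :=
  d (S k) / (INR m + 11 / 12) ^ (S k).

Definition expansion_coefficients (d : nat -> R) : Prop :=
  forall m : nat, (1 <= m)%nat ->
    ex_series (expansion_term d m) /\
    (1 + 1 / INR m) ^ m = exp 1 * (1 - Series (expansion_term d m)).

(* Meaningful for [0 < s < 1]. *)
Definition g (s : R) : R :=
  1 / PI * (Rpower s s * Rpower (1 - s) (1 - s) * sin (PI * s)).

(* Main.v *)
(* Put [s = (1 + cos th) / 2] and [z = e^{i th}], so that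
   [s = (1 + z)^2 / (4 z)], [1 - s = - (1 - z)^2 / (4 z)] and
   [log (s / (1 - s)) + i PI = 4 artanh z] on the upper half circle.  Hence
   [- 4 PI g(s)] is the boundary value of the imaginary part of [G(z) / z], where
   [G(z) = (1 - z)^2 exp ((1 + z)^2 artanh z / z)] is analytic in the unit disc.
   The Poisson-type kernel [sin th / |e^{i th} - q|^2] recovers [G(q)] from these
   boundary values (shown for polynomials, then passed to the limit), and
   [|e^{i th} - q|^2 = - 4 q (x + s)] when [x = - (1 + q)^2 / (4 q)].  Since
   [G(q) = (1 - q)^2 (1 + 1/x)^x], this is the Stieltjes representation
   [(x + 1) (e - (1 + 1/x)^x) = e/2 + int_0^1 g(s) / (x + s) ds].
   Expanding [1 / (x + s)] in powers of [t = 1 / (x + 11/12)] and comparing power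
   series in [t] gives [d_1 = 1/2] and [d_{k+2} + d_{k+1} / 12 = (1/e) int (11/12 - s)^k g],
   which the claimed formula solves. *)
Require Import Defs.
From Stdlib Require Import Reals Lra Lia.
From Coquelicot Require Import Coquelicot.
Open Scope R_scope.

(** * The kernel sin th / |e^{i th} - q|^2 *)

(** Complex analysis is reduced to algebra: [exp w] is approximated by (1 + w/n)^n and artanh by its
    partial sums, so [G] becomes a polynomial, on which the kernel identity is linear in the
    monomials. The artanh series does not converge uniformly on the circle, because of its
    singularities at 1 and -1. Hence the auxiliary radius r < 1: n tends to infinity at fixed r, and
    only then r tends to 1. The factor (1 - z)^2 compensates the growth of the exponential, which
    near z = 1 is that of |1 - z|^(-2), and keeps the boundary values bounded. Even so, their
    convergence as r tends to 1 is not uniform near th = 0; the factor sin th of the kernel repairs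
    this. Dividing [G] by z creates a pole at 0, so the values G(0) and G'(0) enter the formula; for
    r = 1 they are e and 0. Together with (1 - q)^2 = -4 q (x + 1) they produce the factor x + 1 and
    the term e/2. *)

(* [|e^{i th} - q|^2] *)
Definition poisson_den (q th : R) : R := 1 - 2 * q * cos th + q ^ 2.

Lemma poisson_den_ge (q th : R) : (1 - Rabs q) ^ 2 <= poisson_den q th.
Proof.
unfold poisson_den.
destruct (COS_bound th).
unfold Rabs; destruct (Rcase_abs q); nra.
Qed.

Lemma poisson_den_pos (q th : R) : Rabs q < 1 -> 0 < poisson_den q th.
Proof.
intros hq; generalize (poisson_den_ge q th).
assert (0 < (1 - Rabs q) ^ 2) by (apply pow_lt; lra); lra.
Qed.

Definition sine_kernel (q : R) (n : nat) (th : R) : R :=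
  sin (INR n * th) * sin th / poisson_den q th.

Lemma ex_RInt_of_ex_derive (f : R -> R) (a b : R) :
  (forall x, ex_derive f x) -> ex_RInt f a b.
Proof.
intros h; apply (ex_RInt_continuous (V := R_CompleteNormedModule)); intros z _.
now apply (ex_derive_continuous (V := R_NormedModule)).
Qed.

Lemma ex_RInt_sine_kernel (q : R) (n : nat) :
  Rabs q < 1 -> ex_RInt (sine_kernel q n) 0 PI.
Proof.
intros hq; apply ex_RInt_of_ex_derive; intros th.
generalize (poisson_den_pos q th hq); unfold sine_kernel, poisson_den; intros h.
auto_derive; lra.
Qed.

Lemma RInt_sine_kernel_bound (q : R) (n : nat) : Rabs q < 1 ->
  Rabs (RInt (sine_kernel q n) 0 PI) <= PI * / (1 - Rabs q) ^ 2.
Proof.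
intros hq; generalize PI_RGT_0; intros hpi.
replace PI with (PI - 0) at 2 by ring.
apply abs_RInt_le_const; [lra | now apply ex_RInt_sine_kernel |].
intros th _; unfold sine_kernel, Rdiv.
assert (h0 : 0 < (1 - Rabs q) ^ 2) by (apply pow_lt; lra).
generalize (poisson_den_ge q th); intros h1.
rewrite !Rabs_mult.
assert (Rabs (sin (INR n * th)) <= 1) by (apply Rabs_le, SIN_bound).
assert (Rabs (sin th) <= 1) by (apply Rabs_le, SIN_bound).
rewrite (Rabs_pos_eq (/ _)) by (apply Rlt_le, Rinv_0_lt_compat; lra).
assert (/ poisson_den q th <= / (1 - Rabs q) ^ 2) by (apply Rinv_le_contravar; lra).
assert (0 < / poisson_den q th) by (apply Rinv_0_lt_compat; lra).
generalize (Rabs_pos (sin (INR n * th))) (Rabs_pos (sin th)); intros.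
assert (Rabs (sin (INR n * th)) * Rabs (sin th) <= 1) by nra.
nra.
Qed.

Lemma is_RInt_sin_mul_sin (n : nat) : (2 <= n)%nat ->
  is_RInt (fun th => sin (INR n * th) * sin th) 0 PI 0.
Proof.
intros hn.
assert (h2 : 2 <= INR n) by (change 2 with (INR 2); now apply le_INR).
set (F := fun th => (sin ((INR n - 1) * th) / (INR n - 1)
                     - sin ((INR n + 1) * th) / (INR n + 1)) / 2).
evar_last.
apply (is_RInt_derive (V := R_CompleteNormedModule) F); intros th _.
- unfold F; auto_derive; [lra |].
  replace ((INR n - 1) * th) with (INR n * th - th) by ring.
  replace ((INR n + 1) * th) with (INR n * th + th) by ring.
  rewrite cos_minus, cos_plus; field; lra.
- apply (ex_derive_continuous (V := R_NormedModule)); auto_derive; auto.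
- unfold F, minus, plus, opp; simpl.
  rewrite !Rmult_0_r, sin_0.
  replace ((INR n - 1) * PI) with (INR (n - 1) * PI) by (rewrite minus_INR by lia; simpl; ring).
  replace ((INR n + 1) * PI) with (INR (n + 1) * PI) by (rewrite plus_INR; simpl; ring).
  assert (hs : forall k, sin (INR k * PI) = 0).
  { intros k; apply sin_eq_0_1; exists (Z.of_nat k); now rewrite INR_IZR_INZ. }
  rewrite !hs; field; lra.
Qed.

Lemma is_RInt_sin_sqr : is_RInt (fun th => sin (INR 1 * th) * sin th) 0 PI (PI / 2).
Proof.
evar_last.
apply (is_RInt_derive (V := R_CompleteNormedModule) (fun th => (th - sin th * cos th) / 2)); intros th _.
- auto_derive; auto.
  generalize (sin2_cos2 th); unfold Rsqr; simpl; rewrite !Rmult_1_l; intros h; field_simplify.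
  replace (sin th ^ 2) with (1 - cos th ^ 2) by (rewrite <- h; ring); field.
- apply (ex_derive_continuous (V := R_NormedModule)); auto_derive; auto.
- unfold minus, plus, opp; simpl; rewrite sin_PI, sin_0; field.
Qed.

(** Since sin((n+2) th) + sin(n th) = 2 cos th sin((n+1) th), the left side has numerator
    [poisson_den q th] times the right side, and the denominator cancels. *)
Lemma sine_kernel_rec (q : R) (n : nat) (th : R) : Rabs q < 1 ->
  (1 + q ^ 2) * sine_kernel q (S n) th
  - q * (sine_kernel q (S (S n)) th + sine_kernel q n th) = sin (INR (S n) * th) * sin th.
Proof.
intros hq; generalize (poisson_den_pos q th hq); unfold sine_kernel; intros h.
replace (INR (S (S n)) * th) with (INR (S n) * th + th) by (rewrite (S_INR (S n)); ring).
replace (INR n * th) with (INR (S n) * th - th) by (rewrite (S_INR n); ring).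
rewrite sin_plus, sin_minus; unfold poisson_den in *; field; lra.
Qed.

Lemma RInt_sine_kernel_rec (q : R) (n : nat) (l : R) : Rabs q < 1 ->
  is_RInt (fun th => sin (INR (S n) * th) * sin th) 0 PI l ->
  (1 + q ^ 2) * RInt (sine_kernel q (S n)) 0 PI
  - q * (RInt (sine_kernel q (S (S n))) 0 PI + RInt (sine_kernel q n) 0 PI) = l.
Proof.
intros hq hl.
rewrite <- (is_RInt_unique _ _ _ _ hl); symmetry; apply is_RInt_unique.
assert (hk : forall k, is_RInt (sine_kernel q k) 0 PI (RInt (sine_kernel q k) 0 PI))
  by (intros k; apply (RInt_correct (V := R_CompleteNormedModule)); now apply ex_RInt_sine_kernel).
eapply (is_RInt_ext (V := R_NormedModule)).
{ intros th _; now apply (sine_kernel_rec q n th). }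
apply (is_RInt_minus (V := R_NormedModule)); [| apply (is_RInt_scal (V := R_NormedModule) (fun th => _ + _))].
- apply (is_RInt_scal (V := R_NormedModule)), hk.
- now apply (is_RInt_plus (V := R_NormedModule)).
Qed.

(* For the integrals [J n], the sequence [E n = J (n+1) - q J n] satisfies
   [E n = q E (n+1)] and is bounded, so it vanishes. *)
Lemma is_RInt_sine_kernel (q : R) (n : nat) : Rabs q < 1 ->
  is_RInt (sine_kernel q (S n)) 0 PI (PI / 2 * q ^ n).
Proof.
intros hq.
set (J := fun n => RInt (sine_kernel q n) 0 PI).
enough (h : J (S n) = PI / 2 * q ^ n).
{ rewrite <- h; apply (RInt_correct (V := R_CompleteNormedModule)); now apply ex_RInt_sine_kernel. }
assert (hE : forall k, J (S (S k)) - q * J (S k) = q * (J (S (S (S k))) - q * J (S (S k)))).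
{ intros k; generalize (RInt_sine_kernel_rec q (S k) 0 hq (is_RInt_sin_mul_sin (S (S k)) ltac:(lia))).
  fold (J (S (S k))) (J (S (S (S k)))) (J (S k)); lra. }
assert (hEk : forall m k, J (S (S k)) - q * J (S k) = q ^ m * (J (S (S (m + k))) - q * J (S (m + k)))).
{ induction m as [| m IH]; intros k; [simpl; ring |].
  rewrite (IH k), (hE (m + k)%nat); simpl; ring. }
assert (hJ : forall k, J (S (S k)) - q * J (S k) = 0).
{ intros k.
  set (B := 2 * (PI * / (1 - Rabs q) ^ 2)).
  assert (hB : forall m, Rabs (J (S (S k)) - q * J (S k)) <= Rabs q ^ m * B).
  { intros m; rewrite (hEk m k), Rabs_mult, <- RPow_abs.
    apply Rmult_le_compat_l; [apply pow_le, Rabs_pos |].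
    eapply Rle_trans; [apply Rabs_triang |].
    rewrite Rabs_Ropp, Rabs_mult.
    generalize (RInt_sine_kernel_bound q (S (S (m + k))) hq) (RInt_sine_kernel_bound q (S (m + k)) hq)
      (Rabs_pos q) (Rabs_pos (J (S (m + k)))).
    fold (J (S (S (m + k)))) (J (S (m + k))); unfold B; intros; nra. }
  assert (hl : is_lim_seq (fun m => Rabs q ^ m * B) 0).
  { replace (Finite 0) with (Rbar_mult 0 B) by (simpl; f_equal; ring).
    apply is_lim_seq_scal_r, is_lim_seq_geom; now rewrite Rabs_Rabsolu. }
  assert (hle := is_lim_seq_le _ _ _ _ hB (is_lim_seq_const _) hl); simpl in hle.
  generalize (Rabs_pos (J (S (S k)) - q * J (S k))); intros.
  apply Rabs_eq_0; lra. }
assert (h0 : J 0%nat = 0).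
{ unfold J; rewrite (RInt_ext _ (fun _ => 0)); [rewrite RInt_const; apply Rmult_0_r |].
  intros th _; unfold sine_kernel; simpl; rewrite Rmult_0_l, sin_0; unfold Rdiv; ring. }
(* The one recurrence with nonzero right side reads (1 + q^2) J 1 - q (J 2 + J 0) = PI/2; inserting
   J 2 = q J 1 and J 0 = 0 removes q. *)
assert (h1 : J 1%nat = PI / 2).
{ generalize (RInt_sine_kernel_rec q 0 _ hq is_RInt_sin_sqr) (hJ 0%nat).
  fold (J 2%nat) (J 1%nat) (J 0%nat); intros; nra. }
induction n as [| n IH]; [rewrite h1; simpl; ring |].
generalize (hJ n); rewrite IH; simpl; lra.
Qed.

(** * Real polynomials on the unit circle *)

Fixpoint horner (l : list R) (z : C) : C :=
  match l with
  | nil => RtoC 0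
  | (a :: l')%list => (RtoC a + z * horner l' z)%C
  end.

(** Real coefficients make the imaginary part on the unit circle a pure sine polynomial, which
    [sine_kernel] can integrate. The list is existential: closure properties suffice, and the
    coefficients of [stieltjes_poly] are never computed. *)
Definition is_poly (F : C -> C) : Prop := exists l, forall z, F z = horner l z.

Lemma is_poly_ext (F G : C -> C) : (forall z, F z = G z) -> is_poly F -> is_poly G.
Proof. intros h [l hl]; exists l; intros z; now rewrite <- h. Qed.

Lemma is_poly_const (a : R) : is_poly (fun _ => RtoC a).
Proof. exists (a :: nil)%list; intros z; simpl; ring. Qed.

Lemma is_poly_step (a : R) (F : C -> C) : is_poly F -> is_poly (fun z => RtoC a + z * F z)%C.
Proof. intros [l hl]; exists (a :: l)%list; intros z; simpl; now rewrite hl. Qed.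

Lemma is_poly_shift (F : C -> C) : is_poly F -> is_poly (fun z => z * F z)%C.
Proof.
intros hF; apply (is_poly_ext (fun z => RtoC 0 + z * F z)%C); [intros z; ring |].
now apply is_poly_step.
Qed.

Lemma is_poly_plus (F G : C -> C) : is_poly F -> is_poly G -> is_poly (fun z => F z + G z)%C.
Proof.
intros [l hl]; revert F hl G; induction l as [| a l IH]; intros F hl G [k hk].
- exists k; intros z; rewrite hl, hk; simpl; ring.
- destruct k as [| b k].
  + exists (a :: l)%list; intros z; rewrite hl, hk; simpl; ring.
  + apply (is_poly_ext (fun z => RtoC (a + b) + z * (horner l z + horner k z))%C).
    * intros z; rewrite hl, hk, RtoC_plus; simpl; ring.
    * apply is_poly_step, (IH (horner l)); [easy | now exists k].
Qed.

Lemma is_poly_scal (a : R) (F : C -> C) : is_poly F -> is_poly (fun z => RtoC a * F z)%C.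
Proof.
intros [l hl]; revert F hl; induction l as [| b l IH]; intros F hl.
- exists nil; intros z; rewrite hl; simpl; ring.
- apply (is_poly_ext (fun z => RtoC (a * b) + z * (RtoC a * horner l z))%C).
  + intros z; rewrite hl, RtoC_mult; simpl; ring.
  + now apply is_poly_step, IH.
Qed.

Lemma is_poly_mult (F G : C -> C) : is_poly F -> is_poly G -> is_poly (fun z => F z * G z)%C.
Proof.
intros [l hl] hG; revert F hl; induction l as [| a l IH]; intros F hl.
- exists nil; intros z; rewrite hl; simpl; ring.
- apply (is_poly_ext (fun z => RtoC a * G z + z * (horner l z * G z))%C).
  + intros z; rewrite hl; simpl; ring.
  + apply is_poly_plus; [now apply is_poly_scal |]; apply is_poly_shift.
    now apply (IH (horner l)).
Qed.

(** Only the first two Taylor coefficients are tracked, because they are all that the division by z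
    in [is_RInt_jet] brings to light. *)
Definition has_jet (F : C -> C) (b0 b1 : R) : Prop :=
  exists H, is_poly H /\ forall z, F z = (RtoC b0 + RtoC b1 * z + z * z * H z)%C.

Lemma has_jet_const (a : R) : has_jet (fun _ => RtoC a) a 0.
Proof.
exists (fun _ => RtoC 0); split; [apply is_poly_const |]; intros z; ring.
Qed.

Lemma has_jet_plus (F G : C -> C) (a0 a1 b0 b1 : R) : has_jet F a0 a1 -> has_jet G b0 b1 ->
  has_jet (fun z => F z + G z)%C (a0 + b0) (a1 + b1).
Proof.
intros [H [pH hH]] [K [pK hK]]; exists (fun z => H z + K z)%C; split.
- now apply is_poly_plus.
- intros z; rewrite hH, hK, !RtoC_plus; ring.
Qed.

Lemma has_jet_mult (F G : C -> C) (a0 a1 b0 b1 : R) : has_jet F a0 a1 -> has_jet G b0 b1 ->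
  has_jet (fun z => F z * G z)%C (a0 * b0) (a0 * b1 + a1 * b0).
Proof.
intros [H [pH hH]] [K [pK hK]].
exists (fun z => RtoC (a1 * b1) + RtoC a0 * K z + RtoC b0 * H z
   + z * (RtoC a1 * K z + RtoC b1 * H z + z * (H z * K z)))%C; split.
- repeat first [ apply is_poly_plus | apply is_poly_shift | apply is_poly_scal
    | apply is_poly_mult | apply is_poly_const | assumption ].
- intros z; rewrite hH, hK, !RtoC_plus, !RtoC_mult; ring.
Qed.

Lemma has_jet_pow (F : C -> C) (a0 a1 : R) (n : nat) : has_jet F a0 a1 ->
  has_jet (fun z => F z ^ n)%C (a0 ^ n) (INR n * a0 ^ (n - 1) * a1).
Proof.
intros hF; induction n as [| n IH].
- simpl; rewrite !Rmult_0_l; apply has_jet_const.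
- assert (h := has_jet_mult _ _ _ _ _ _ hF IH).
  replace (INR (S n) * a0 ^ (S n - 1) * a1)
    with (a0 * (INR n * a0 ^ (n - 1) * a1) + a1 * a0 ^ n); [exact h |].
  rewrite S_INR; replace (S n - 1)%nat with n by lia.
  destruct n as [| n]; [simpl; ring |].
  replace (S n - 1)%nat with n by lia; simpl; ring.
Qed.

Definition cis (th : R) : C := (cos th, sin th).

Lemma cis_pow (th : R) (n : nat) : (cis th ^ n)%C = cis (INR n * th).
Proof.
induction n as [| n IH].
- simpl; unfold cis; rewrite Rmult_0_l, cos_0, sin_0; reflexivity.
- rewrite Cpow_S, IH, S_INR, Rmult_plus_distr_r, Rmult_1_l.
  unfold cis, Cmult; simpl; rewrite cos_plus, sin_plus; f_equal; ring.
Qed.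

(** By linearity: the coefficient of z^(k+1) contributes a multiple of sin((k+1) th), which the
    kernel sends to PI/2 q^k. The exponent [n] is general because peeling off a coefficient raises
    the power of z in front of the rest. *)
Lemma is_RInt_horner (l : list R) (q : R) (n : nat) : Rabs q < 1 ->
  is_RInt (fun th => Im (cis th ^ (S n) * horner l (cis th)) * sin th / poisson_den q th)
    0 PI (PI / 2 * (q ^ n * Re (horner l (RtoC q)))).
Proof.
intros hq; revert n; induction l as [| a l IH]; intros n.
- replace (PI / 2 * _) with 0 by (simpl; ring).
  apply (is_RInt_ext (V := R_NormedModule) (fun _ => 0)).
  + intros th _; simpl; unfold Rdiv; ring.
  + evar_last; [apply (is_RInt_const (V := R_NormedModule)) | apply Rmult_0_r].
- replace (PI / 2 * _) with (a * (PI / 2 * q ^ n) + PI / 2 * (q ^ S n * Re (horner l (RtoC q))))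
    by (unfold Re; simpl; ring).
  apply (is_RInt_ext (V := R_NormedModule) (fun th => plus (scal a (sine_kernel q (S n) th))
     (Im (cis th ^ (S (S n)) * horner l (cis th)) * sin th / poisson_den q th))).
  + intros th _; unfold plus, scal; simpl; unfold mult; simpl.
    replace (sine_kernel q (S n) th)
      with (Im (cis th ^ (S n))%C * sin th / poisson_den q th) by (rewrite cis_pow; reflexivity).
    simpl; unfold Rdiv; ring.
  + apply (is_RInt_plus (V := R_NormedModule)); [| apply IH].
    now apply (is_RInt_scal (V := R_NormedModule)), is_RInt_sine_kernel.
Qed.

(** On the circle the conjugate of z is 1/z, so the integrand comes from b0/z + b1 + z H(z). The
    first term has imaginary part -b0 sin th, the second is real and drops out, and the third yields
    H(q) = (F(q) - b0 - b1 q) / q^2. *)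
Lemma is_RInt_jet (F : C -> C) (b0 b1 q : R) : has_jet F b0 b1 -> Rabs q < 1 -> q <> 0 ->
  is_RInt (fun th => Im (Cconj (cis th) * F (cis th)) * sin th / poisson_den q th)
    0 PI (PI / 2 * ((Re (F (RtoC q)) - b0 - b1 * q) / q ^ 2 - b0)).
Proof.
intros [H [[l hl] hH]] hq hq0.
apply (is_RInt_ext (V := R_NormedModule) (fun th => minus
  (Im (cis th ^ 1 * horner l (cis th)) * sin th / poisson_den q th)
  (scal b0 (sine_kernel q 1 th)))).
- intros th _.
  change (Im (cis th ^ 1 * horner l (cis th)) * sin th / poisson_den q th
    - b0 * sine_kernel q 1 th = Im (Cconj (cis th) * F (cis th)) * sin th / poisson_den q th).
  assert (e : (Cconj (cis th) * F (cis th))%C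
    = (RtoC b0 * Cconj (cis th) + (RtoC b1 + cis th * horner l (cis th)))%C).
  { rewrite hH, hl.
    assert (e1 : (Cconj (cis th) * cis th)%C = RtoC 1).
    { unfold cis, Cconj, Cmult, RtoC; simpl; f_equal; [| ring].
      generalize (sin2_cos2 th); unfold Rsqr; lra. }
    transitivity (RtoC b0 * Cconj (cis th)
      + (Cconj (cis th) * cis th) * (RtoC b1 + cis th * horner l (cis th)))%C; [ring |].
    rewrite e1; ring. }
  rewrite e; unfold sine_kernel, Im, Rdiv; simpl; rewrite Rmult_1_l; ring.
- replace (PI / 2 * _) with (PI / 2 * (q ^ 0 * Re (horner l (RtoC q))) - b0 * (PI / 2 * q ^ 0)).
  + apply (is_RInt_minus (V := R_NormedModule)); [now apply is_RInt_horner |].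
    now apply (is_RInt_scal (V := R_NormedModule)), (is_RInt_sine_kernel q 0).
  + rewrite hH, hl; unfold Re; simpl; field; lra.
Qed.

(** * The complex exponential as a limit of (1 + w/n)^n *)

Lemma lipschitz_of_derive (f df : R -> R) (a b M : R) :
  (forall x, Rmin a b <= x <= Rmax a b -> is_derive f x (df x)) ->
  (forall x, Rmin a b <= x <= Rmax a b -> Rabs (df x) <= M) ->
  Rabs (f b - f a) <= M * Rabs (b - a).
Proof.
intros hd hM.
destruct (MVT_gen f a b df) as [c [hc e]].
- intros x hx; apply hd; lra.
- intros x hx; apply continuity_pt_filterlim, (ex_derive_continuous (V := R_NormedModule)).
  exists (df x); now apply hd.
- rewrite e, Rabs_mult; apply Rmult_le_compat_r; [apply Rabs_pos | now apply hM].
Qed.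

Lemma Rabs_sin_minus_le (x y : R) : Rabs (sin y - sin x) <= Rabs (y - x).
Proof.
rewrite <- (Rmult_1_l (Rabs (y - x))); apply (lipschitz_of_derive sin cos).
- intros z _; auto_derive; [easy | ring].
- intros z _; apply Rabs_le, COS_bound.
Qed.

Lemma Rabs_sin_le (x : R) : Rabs (sin x) <= Rabs x.
Proof. generalize (Rabs_sin_minus_le 0 x); now rewrite sin_0, !Rminus_0_r. Qed.

Lemma one_minus_cos_bound (x : R) : 0 <= 1 - cos x <= x ^ 2 / 2.
Proof.
destruct (COS_bound x); split; [lra |].
replace x with (2 * (x / 2)) at 1 by field.
rewrite cos_2a_sin.
assert (h := Rabs_sin_le (x / 2)); apply Rsqr_le_abs_1 in h; unfold Rsqr in h; lra.
Qed.

Lemma Rabs_sin_sub_id_le (x : R) : Rabs x <= 1 / 2 -> Rabs (sin x - x) <= x ^ 2.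
Proof.
intros hx.
replace (sin x - x) with ((sin x - x) - (sin 0 - 0)) by (rewrite sin_0; ring).
eapply Rle_trans.
- apply (lipschitz_of_derive (fun x => sin x - x) (fun x => cos x - 1) 0 x (Rabs x)).
  + intros z _; auto_derive; [easy | ring].
  + intros z hz; destruct (one_minus_cos_bound z).
    assert (Rabs z <= Rabs x).
    { revert hz; unfold Rmin, Rmax; destruct (Rle_dec 0 x); intros;
      unfold Rabs; repeat destruct Rcase_abs; lra. }
    rewrite Rabs_minus_sym, Rabs_pos_eq by lra.
    generalize (Rabs_pos z) (pow2_abs z); intros; nra.
- rewrite Rminus_0_r, <- (pow2_abs x); right; ring.
Qed.

Lemma exp_sub_affine_bound (x : R) : Rabs x <= 1 / 2 -> 0 <= exp x - 1 - x <= 2 * x ^ 2.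
Proof.
intros hx; apply Rabs_le_between in hx.
generalize (exp_ineq1_le x) (exp_ineq1_le (- x)); intros h1 h2; split; [lra |].
assert (e : exp x * exp (- x) = 1) by (rewrite <- exp_plus, Rplus_opp_r; apply exp_0).
generalize (exp_pos x); intros h3.
assert (exp x * (1 - x) <= 1) by nra.
(* The product equals 1 + x^2 (1 - 2 x), and x <= 1/2. *)
assert (1 <= (1 + x + 2 * x ^ 2) * (1 - x)) by nra.
nra.
Qed.

Lemma exp_pow_INR (x : R) (n : nat) : exp x ^ n = exp (INR n * x).
Proof.
induction n as [| n IH]; [simpl; now rewrite Rmult_0_l, exp_0 |].
rewrite S_INR; simpl pow; rewrite IH, <- exp_plus; f_equal; ring.
Qed.

Lemma Cmod_le_Rabs_Rabs (z : C) : Cmod z <= Rabs (Re z) + Rabs (Im z).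
Proof.
unfold Cmod, Re, Im; apply Rsqr_incr_0_var.
- rewrite Rsqr_sqrt by nra.
  generalize (pow2_abs (fst z)) (pow2_abs (snd z)) (Rabs_pos (fst z)) (Rabs_pos (snd z)).
  unfold Rsqr; intros; nra.
- generalize (Rabs_pos (fst z)) (Rabs_pos (snd z)); lra.
Qed.

Lemma im_le_Cmod (z : C) : Rabs (Im z) <= Cmod z.
Proof. eapply Rle_trans; [apply Rmax_r | apply Rmax_Cmod]. Qed.

Definition cexp (z : C) : C := (exp (Re z) * cos (Im z), exp (Re z) * sin (Im z)).

Lemma cexp_plus (z w : C) : cexp (z + w) = (cexp z * cexp w)%C.
Proof.
unfold cexp, Cmult, Re, Im; simpl.
rewrite exp_plus, cos_plus, sin_plus; f_equal; ring.
Qed.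

Lemma Cmod_cexp (z : C) : Cmod (cexp z) <= exp (Cmod z).
Proof.
replace (Cmod (cexp z)) with (exp (Re z)).
- generalize (re_le_Cmod z) (Rle_abs (Re z)); intros h1 h2.
  destruct (Rle_lt_or_eq_dec (Re z) (Cmod z)) as [h | h]; [lra | |].
  + now apply Rlt_le, exp_increasing.
  + rewrite h; lra.
- unfold Cmod, cexp; simpl.
  replace (_ + _) with (Rsqr (exp (Re z))); [now rewrite sqrt_Rsqr by (apply Rlt_le, exp_pos) |].
  generalize (sin2_cos2 (Im z)); unfold Rsqr; intros h.
  transitivity (exp (Re z) * exp (Re z) * (sin (Im z) * sin (Im z) + cos (Im z) * cos (Im z)));
    [rewrite h |]; ring.
Qed.

Lemma cexp_pow (z : C) (n : nat) : (cexp z ^ n)%C = cexp (RtoC (INR n) * z).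
Proof.
induction n as [| n IH].
- replace (RtoC (INR 0) * z)%C with (RtoC 0) by (simpl; ring).
  unfold cexp; simpl; now rewrite exp_0, cos_0, sin_0, Rmult_1_l, Rmult_0_r.
- rewrite Cpow_S, IH, <- cexp_plus; f_equal; rewrite S_INR, RtoC_plus; ring.
Qed.

Lemma Cmod_cexp_sub_affine (z : C) : Cmod z <= 1 / 2 ->
  Cmod (cexp z - (RtoC 1 + z)) <= 5 * Cmod z ^ 2.
Proof.
intros hz.
assert (hx := Rle_trans _ _ _ (re_le_Cmod z) hz).
assert (hy := Rle_trans _ _ _ (im_le_Cmod z) hz).
rewrite Cmod2_alt.
eapply Rle_trans; [apply Cmod_le_Rabs_Rabs |].
destruct z as [x y]; unfold Re, Im in *; simpl fst in *; simpl snd in *.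
destruct (exp_sub_affine_bound x hx) as [e0 e1].
destruct (one_minus_cos_bound y) as [c0 c1].
assert (s1 := Rabs_sin_sub_id_le y hy).
assert (s2 := Rabs_sin_le y).
replace (exp x * cos y + - (1 + x)) with ((exp x - 1 - x) * cos y - (1 + x) * (1 - cos y)) by ring.
replace (exp x * sin y + - (0 + y)) with ((exp x - 1) * sin y + (sin y - y)) by ring.
apply Rabs_le_between in hx; apply Rabs_le_between in hy.
assert (h1 : Rabs ((exp x - 1 - x) * cos y - (1 + x) * (1 - cos y)) <= 2 * x ^ 2 + y ^ 2).
{ destruct (COS_bound y); eapply Rle_trans; [apply Rabs_triang |].
  rewrite Rabs_Ropp, !Rabs_mult, !(Rabs_pos_eq (_ - _)), (Rabs_pos_eq (1 + x)) by lra.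
  assert (Rabs (cos y) <= 1) by (apply Rabs_le; lra).
  apply Rplus_le_compat; [generalize (Rabs_pos (cos y)); intros |]; nra. }
assert (h2 : Rabs ((exp x - 1) * sin y) <= 2 * (Rabs x * Rabs y)).
{ assert (Rabs (exp x - 1) <= 2 * Rabs x)
    by (apply Rabs_le; unfold Rabs; destruct Rcase_abs; split; nra).
  rewrite Rabs_mult; generalize (Rabs_pos x) (Rabs_pos y) (Rabs_pos (sin y)); intros; nra. }
assert (h3 := Rabs_triang ((exp x - 1) * sin y) (sin y - y)).
generalize (pow2_abs x) (pow2_abs y) (Rabs_pos x) (Rabs_pos y); intros.
assert (2 * (Rabs x * Rabs y) <= x ^ 2 + y ^ 2).
{ generalize (pow2_ge_0 (Rabs x - Rabs y)); intros; nra. }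
generalize (pow2_ge_0 x) (pow2_ge_0 y); intros; lra.
Qed.

Lemma Cmod_pow_minus (a b : C) (r : R) (n : nat) : 1 <= r -> Cmod a <= r -> Cmod b <= r ->
  Cmod (a ^ n - b ^ n) <= INR n * r ^ n * Cmod (a - b).
Proof.
intros hr ha hb; induction n as [| n IH].
- replace (a ^ 0 - b ^ 0)%C with (RtoC 0) by (simpl; ring).
  rewrite Cmod_0; simpl; lra.
- replace (a ^ S n - b ^ S n)%C with (a * (a ^ n - b ^ n) + (a - b) * b ^ n)%C by (simpl; ring).
  eapply Rle_trans; [apply Cmod_triangle |].
  rewrite !Cmod_mult, Cmod_pow, S_INR; simpl.
  assert (hbn : Cmod b ^ n <= r ^ n) by (apply pow_incr; split; [apply Cmod_ge_0 | easy]).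
  assert (hrn : 1 <= r ^ n) by now apply pow_R1_Rle.
  generalize (Cmod_ge_0 (a ^ n - b ^ n)) (Cmod_ge_0 a) (Cmod_ge_0 (a - b)); intros h1 h2 h3.
  assert (h4 : Cmod a * Cmod (a ^ n - b ^ n) <= r * (INR n * r ^ n * Cmod (a - b)))
    by (apply Rmult_le_compat; lra).
  assert (h5 : Cmod (a - b) * Cmod b ^ n <= Cmod (a - b) * (r * r ^ n)).
  { apply Rmult_le_compat_l; [easy |]; nra. }
  nra.
Qed.

(** Compare n-th powers of exp(z/n) and 1 + w/n. Both bases have modulus at most exp(K/n), whose
    n-th power is exp K, and they differ by 5 (K/n)^2 + delta/n at most; [Cmod_pow_minus] costs a
    factor n. Letting w differ from z allows artanh to be truncated at the same time. *)
Lemma cexp_euler_bound (z w : C) (K delta : R) (n : nat) :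
  Cmod z <= K -> Cmod w <= K -> Cmod (z - w) <= delta -> (1 <= n)%nat -> 2 * K <= INR n ->
  Cmod (cexp z - (RtoC 1 + RtoC (/ INR n) * w) ^ n) <= exp K * (5 * K ^ 2 / INR n + delta).
Proof.
intros hz hw hzw hn1 hn.
assert (hn0 : 1 <= INR n) by (change 1 with (INR 1); now apply le_INR).
assert (hi : 0 < / INR n) by (apply Rinv_0_lt_compat; lra).
assert (hK : 0 <= K) by (generalize (Cmod_ge_0 z); lra).
set (u := (RtoC (/ INR n) * z)%C).
assert (hmod : forall v, Cmod v <= K -> Cmod (RtoC (/ INR n) * v) <= K / INR n).
{ intros v hv; rewrite Cmod_mult, Cmod_R, Rabs_pos_eq by lra; unfold Rdiv; nra. }
assert (hu := hmod z hz); fold u in hu.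
replace (cexp z) with (cexp u ^ n)%C.
2:{ rewrite cexp_pow; f_equal; unfold u; rewrite Cmult_assoc, <- RtoC_mult.
    rewrite Rinv_r by lra; ring. }
assert (hKn : exp (K / INR n) ^ n = exp K).
{ rewrite exp_pow_INR; f_equal; field; lra. }
assert (hlin := exp_ineq1_le (K / INR n)).
assert (hKn0 : 0 <= K / INR n) by (apply Rle_div_r; lra).
eapply Rle_trans; [apply (Cmod_pow_minus _ _ (exp (K / INR n))) |].
- lra.
- eapply Rle_trans; [apply Cmod_cexp |].
  destruct hu as [hu | hu]; [now apply Rlt_le, exp_increasing | rewrite hu; lra].
- eapply Rle_trans; [apply Cmod_triangle |].
  rewrite Cmod_1; generalize (hmod w hw); lra.
- rewrite hKn.
  assert (hu2 : Cmod (cexp u - (RtoC 1 + u)) <= 5 * (K / INR n) ^ 2).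
  { assert (K / INR n <= 1 / 2) by (apply Rle_div_l; lra).
    eapply Rle_trans; [apply Cmod_cexp_sub_affine; lra |].
    apply Rmult_le_compat_l; [lra |]; apply pow_incr; split; [apply Cmod_ge_0 | easy]. }
  assert (hd : Cmod (cexp u - (RtoC 1 + RtoC (/ INR n) * w)) <= 5 * (K / INR n) ^ 2 + delta / INR n).
  { replace (cexp u - (RtoC 1 + RtoC (/ INR n) * w))%C
      with ((cexp u - (RtoC 1 + u)) + RtoC (/ INR n) * (z - w))%C by (unfold u; ring).
    eapply Rle_trans; [apply Cmod_triangle |].
    rewrite Cmod_mult, Cmod_R, (Rabs_pos_eq (/ INR n)) by lra.
    unfold Rdiv at 2; nra. }
  replace (5 * K ^ 2 / INR n + delta)
    with (INR n * (5 * (K / INR n) ^ 2 + delta / INR n)) by (field; lra).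
  generalize (exp_pos K); intros.
  rewrite (Rmult_comm (INR n) (exp K)), Rmult_assoc.
  apply Rmult_le_compat_l; [lra |]; apply Rmult_le_compat_l; lra.
Qed.

(** * Partial sums of artanh *)

(** With [f] equal to [cos] or [sin] this is the real or imaginary part of a partial sum of artanh(r
    e^{i th}). Keeping [f] abstract treats both at once and needs only real derivatives in r. *)
Fixpoint artanh_sum (f : R -> R) (th : R) (N : nat) (r : R) : R :=
  match N with
  | O => 0
  | S k => artanh_sum f th k r + f (INR (2 * k + 1) * th) / INR (2 * k + 1) * r ^ (2 * k + 1)
  end.

Fixpoint geom_sum (f : R -> R) (th : R) (N : nat) (r : R) : R :=
  match N with
  | O => 0
  | S k => geom_sum f th k r + f (INR (2 * k + 1) * th) * r ^ (2 * k)
  end.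

Lemma is_derive_artanh_sum (f : R -> R) (th : R) (N : nat) (r : R) :
  is_derive (artanh_sum f th N) r (geom_sum f th N r).
Proof.
induction N as [| N IH]; simpl artanh_sum; simpl geom_sum.
- auto_derive; easy.
- apply (is_derive_plus (V := R_NormedModule)); [exact IH |].
  auto_derive; [easy |].
  replace (N + (N + 0) + 1)%nat with (S (2 * N)) by lia.
  rewrite <- pred_Sn; replace (N + (N + 0))%nat with (2 * N)%nat by lia.
  assert (INR (S (2 * N)) <> 0) by now apply not_0_INR.
  field; easy.
Qed.

(* [artanh_re] and [artanh_im] are the real and imaginary parts of [artanh (r e^{i th})]. *)
Definition artanh_re (th r : R) : R :=
  / 4 * (ln (poisson_den (- r) th) - ln (poisson_den r th)).

Definition artanh_im (th r : R) : R := / 2 * atan (2 * r * sin th / (1 - r ^ 2)).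

(* [|1 - r^2 e^{2 i th}|^2] *)
Definition artanh_den (th r : R) : R := (1 - r ^ 2) ^ 2 + 4 * r ^ 2 * sin th ^ 2.

Lemma sqr_lt_1 (r : R) : Rabs r < 1 -> r ^ 2 < 1.
Proof. intros h; rewrite <- pow2_abs; generalize (Rabs_pos r); nra. Qed.

Lemma artanh_den_ge (th r : R) : (1 - r ^ 2) ^ 2 <= artanh_den th r.
Proof.
unfold artanh_den; generalize (pow2_ge_0 r) (pow2_ge_0 (sin th)); nra.
Qed.

Lemma artanh_den_pos (th r : R) : Rabs r < 1 -> 0 < artanh_den th r.
Proof.
intros h; generalize (artanh_den_ge th r) (sqr_lt_1 r h); intros.
assert (0 < (1 - r ^ 2) ^ 2) by (apply pow_lt; lra); lra.
Qed.

Lemma sin_sqr (x : R) : sin x ^ 2 = 1 - cos x ^ 2.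
Proof. generalize (sin2_cos2 x); unfold Rsqr; lra. Qed.

Lemma artanh_den_factor (th r : R) : artanh_den th r = poisson_den (- r) th * poisson_den r th.
Proof. unfold artanh_den, poisson_den; rewrite sin_sqr; ring. Qed.

Lemma is_derive_artanh_re (th r : R) : Rabs r < 1 ->
  is_derive (artanh_re th) r (cos th * (1 - r ^ 2) / artanh_den th r).
Proof.
intros h; rewrite artanh_den_factor.
generalize (poisson_den_pos r th h) (poisson_den_pos (- r) th ltac:(now rewrite Rabs_Ropp)).
unfold artanh_re, poisson_den; intros h1 h2; auto_derive; [lra | field; lra].
Qed.

Lemma is_derive_artanh_im (th r : R) : Rabs r < 1 ->
  is_derive (artanh_im th) r (sin th * (1 + r ^ 2) / artanh_den th r).
Proof.
intros h; generalize (sqr_lt_1 r h) (artanh_den_pos th r h).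
unfold artanh_im, artanh_den; intros h1 h2; auto_derive; [lra |].
field; simpl in *; repeat split; lra.
Qed.

(** This is the tail of a geometric series of ratio r^2 e^{2 i th}, with denominator made real by
    the conjugate factor. The hypothesis on [f] is the linear recurrence shared by [cos] and [sin],
    which makes the induction step telescope. *)
Lemma geom_sum_closed (f : R -> R) (th : R) (N : nat) (r v : R) : Rabs r < 1 ->
  (forall x, f (x + 2 * th) + f (x - 2 * th) = 2 * cos (2 * th) * f x) ->
  v = f th - r ^ 2 * f (- th) ->
  geom_sum f th N r - v / artanh_den th r
  = - r ^ (2 * N) * (f (INR (2 * N + 1) * th) - r ^ 2 * f (INR (2 * N + 1) * th - 2 * th))
    / artanh_den th r.
Proof.
intros hr hf hv; generalize (artanh_den_pos th r hr); intros hd.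
induction N as [| N IH].
- simpl; rewrite Rmult_1_l; replace (th - 2 * th) with (- th) by ring.
  rewrite hv; field; lra.
- simpl geom_sum.
  transitivity (geom_sum f th N r - v / artanh_den th r
     + f (INR (2 * N + 1) * th) * r ^ (2 * N)); [simpl; ring |].
  rewrite IH; set (x := INR (2 * N + 1) * th).
  replace (INR (2 * S N + 1) * th) with (x + 2 * th)
    by (unfold x; replace (2 * S N + 1)%nat with (2 * N + 1 + 2)%nat by lia;
        rewrite (plus_INR (2 * N + 1) 2); simpl; ring).
  replace (x + 2 * th - 2 * th) with x by ring.
  replace (f (x + 2 * th)) with (2 * cos (2 * th) * f x - f (x - 2 * th)) by (rewrite <- hf; ring).
  replace (2 * S N)%nat with (2 * N + 2)%nat by lia; rewrite pow_add.
  assert (e : artanh_den th r = 1 - 2 * r ^ 2 * cos (2 * th) + r ^ 4)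
    by (unfold artanh_den; rewrite cos_2a_sin; ring).
  transitivity (r ^ (2 * N) * (f x * artanh_den th r - f x + r ^ 2 * f (x - 2 * th)) / artanh_den th r);
    [field; lra |].
  apply f_equal2; [| easy]; rewrite e; ring.
Qed.

(** The tail in [geom_sum_closed] has numerator at most 2 r^(2N) and denominator at least (1 -
    r^2)^2, so this bound is uniform in th. *)
Definition artanh_err (r : R) (N : nat) : R := 2 * (r ^ 2) ^ N / (1 - r ^ 2) ^ 2.

(* Compare the derivatives along the ray from 0 to [r]. *)
Lemma artanh_sum_bound (f F : R -> R) (th r : R) (N : nat) : Rabs r < 1 ->
  (forall x, f (x + 2 * th) + f (x - 2 * th) = 2 * cos (2 * th) * f x) ->
  (forall x, Rabs (f x) <= 1) ->
  F 0 = 0 ->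
  (forall x, Rabs x < 1 -> is_derive F x ((f th - x ^ 2 * f (- th)) / artanh_den th x)) ->
  Rabs (artanh_sum f th N r - F r) <= artanh_err r N.
Proof.
unfold artanh_err.
intros hr hf hf1 hF0 hF.
assert (hr2 := sqr_lt_1 r hr).
assert (h0 : artanh_sum f th N 0 = 0).
{ induction N as [| N IH]; [easy |]; simpl; rewrite IH.
  rewrite Nat.add_1_r; simpl; ring. }
replace (artanh_sum f th N r - F r)
  with ((artanh_sum f th N r - F r) - (artanh_sum f th N 0 - F 0)) by (rewrite h0, hF0; ring).
assert (hx : forall x, Rmin 0 r <= x <= Rmax 0 r -> Rabs x <= Rabs r).
{ intros x; unfold Rmin, Rmax; destruct (Rle_dec 0 r); intros;
  unfold Rabs; repeat destruct Rcase_abs; lra. }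
assert (hB : 0 <= 2 * (r ^ 2) ^ N / (1 - r ^ 2) ^ 2).
{ apply Rmult_le_pos; [| apply Rlt_le, Rinv_0_lt_compat, pow_lt; lra].
  apply Rmult_le_pos; [lra |]; apply pow_le, pow2_ge_0. }
eapply Rle_trans.
- apply (lipschitz_of_derive (fun x => artanh_sum f th N x - F x)
    (fun x => geom_sum f th N x - (f th - x ^ 2 * f (- th)) / artanh_den th x) 0 r
    (2 * (r ^ 2) ^ N / (1 - r ^ 2) ^ 2)).
  + intros x h; assert (hx1 := hx x h).
    apply (is_derive_minus (V := R_NormedModule)); [apply is_derive_artanh_sum | apply hF; lra].
  + intros x h; assert (hx1 := hx x h).
    assert (hx2 : Rabs x < 1) by lra.
    rewrite (geom_sum_closed f th N x _ hx2 hf eq_refl).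
    assert (hxr : 0 <= x ^ 2 <= r ^ 2).
    { split; [apply pow2_ge_0 |]; rewrite <- (pow2_abs x), <- (pow2_abs r).
      apply pow_incr; split; [apply Rabs_pos | easy]. }
    unfold Rdiv; rewrite !Rabs_mult, Rabs_Ropp.
    apply (Rle_trans _ ((r ^ 2) ^ N * 2 * / (1 - r ^ 2) ^ 2)); [| right; ring].
    apply Rmult_le_compat.
    * apply Rmult_le_pos; apply Rabs_pos.
    * apply Rabs_pos.
    * apply Rmult_le_compat; try apply Rabs_pos.
      -- rewrite pow_mult, Rabs_pos_eq by (apply pow_le, pow2_ge_0); now apply pow_incr.
      -- eapply Rle_trans; [apply Rabs_triang |].
         rewrite Rabs_Ropp, Rabs_mult, (Rabs_pos_eq (x ^ 2)) by apply pow2_ge_0.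
         generalize (hf1 (INR (2 * N + 1) * th)) (hf1 (INR (2 * N + 1) * th - 2 * th))
           (Rabs_pos (f (INR (2 * N + 1) * th - 2 * th))); intros; nra.
    * rewrite Rabs_pos_eq by (now apply Rlt_le, Rinv_0_lt_compat, artanh_den_pos).
      apply Rinv_le_contravar; [apply pow_lt; lra |].
      apply (Rle_trans _ ((1 - x ^ 2) ^ 2)); [| apply artanh_den_ge].
      apply pow_incr; lra.
- rewrite Rminus_0_r; generalize (Rabs_pos r); intros; nra.
Qed.

Lemma artanh_sum_cos_bound (th r : R) (N : nat) : Rabs r < 1 ->
  Rabs (artanh_sum cos th N r - artanh_re th r) <= artanh_err r N.
Proof.
intros hr; apply artanh_sum_bound with (1 := hr).
- intros x; rewrite cos_plus, cos_minus; ring.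
- intros x; apply Rabs_le, COS_bound.
- unfold artanh_re; rewrite Ropp_0; ring.
- intros x hx; rewrite cos_neg.
  replace (cos th - x ^ 2 * cos th) with (cos th * (1 - x ^ 2)) by ring.
  now apply is_derive_artanh_re.
Qed.

Lemma artanh_sum_sin_bound (th r : R) (N : nat) : Rabs r < 1 ->
  Rabs (artanh_sum sin th N r - artanh_im th r) <= artanh_err r N.
Proof.
intros hr; apply artanh_sum_bound with (1 := hr).
- intros x; rewrite sin_plus, sin_minus; ring.
- intros x; apply Rabs_le, SIN_bound.
- unfold artanh_im; rewrite Rmult_0_r, Rmult_0_l; unfold Rdiv; rewrite Rmult_0_l, atan_0; ring.
- intros x hx; rewrite sin_neg.
  replace (sin th - x ^ 2 * - sin th) with (sin th * (1 + x ^ 2)) by ring.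
  now apply is_derive_artanh_im.
Qed.

Lemma is_lim_seq_artanh_err (r : R) : Rabs r < 1 -> is_lim_seq (artanh_err r) 0.
Proof.
intros hr; assert (h := sqr_lt_1 r hr); generalize (pow2_ge_0 r); intros h0.
apply (is_lim_seq_ext (fun N => (r ^ 2) ^ N * (2 / (1 - r ^ 2) ^ 2))).
- intros N; unfold artanh_err; field; lra.
- replace (Finite 0) with (Rbar_mult 0 (2 / (1 - r ^ 2) ^ 2)) by (simpl; f_equal; ring).
  apply is_lim_seq_scal_r, is_lim_seq_geom; now rewrite Rabs_pos_eq.
Qed.

(* The partial sums of [artanh (r z) / z], as polynomials in [z]. *)
Fixpoint artanh_poly (r : R) (N : nat) (z : C) : C :=
  match N with
  | O => RtoC 0
  | S k => (artanh_poly r k z + RtoC (r ^ (2 * k + 1) / INR (2 * k + 1)) * z ^ (2 * k))%C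
  end.

Lemma artanh_poly_cis (r th : R) (N : nat) :
  (cis th * artanh_poly r N (cis th))%C = (artanh_sum cos th N r, artanh_sum sin th N r).
Proof.
induction N as [| N IH]; simpl artanh_poly; simpl artanh_sum.
- apply Cmult_0_r.
- replace (N + (N + 0))%nat with (2 * N)%nat by lia.
  rewrite Cmult_plus_distr_l, IH.
  replace (cis th * (RtoC (r ^ (2 * N + 1) / INR (2 * N + 1)) * cis th ^ (2 * N)))%C
    with (RtoC (r ^ (2 * N + 1) / INR (2 * N + 1)) * cis th ^ (2 * N + 1))%C
    by (rewrite Nat.add_1_r, Cpow_S; ring).
  generalize (2 * N + 1)%nat; intros k.
  rewrite cis_pow; unfold cis, Cplus, Cmult, RtoC; simpl fst; simpl snd.
  f_equal; unfold Rdiv; ring.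
Qed.

Lemma artanh_poly_real (r q : R) (N : nat) :
  (RtoC q * artanh_poly r N (RtoC q))%C = RtoC (artanh_sum cos 0 N (r * q)).
Proof.
induction N as [| N IH]; simpl artanh_poly; simpl artanh_sum.
- apply Cmult_0_r.
- replace (N + (N + 0))%nat with (2 * N)%nat by lia.
  rewrite Cmult_plus_distr_l, IH.
  rewrite <- RtoC_pow, <- !RtoC_mult, <- RtoC_plus; f_equal.
  rewrite Rmult_0_r, cos_0, Rpow_mult_distr.
  rewrite (pow_add q); unfold Rdiv; ring.
Qed.

Lemma has_jet_id : has_jet (fun z => z) 0 1.
Proof.
exists (fun _ => RtoC 0); split; [apply is_poly_const |]; intros z; ring.
Qed.

Lemma has_jet_artanh_poly (r : R) (N : nat) : has_jet (artanh_poly r (S N)) r 0.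
Proof.
induction N as [| N IH].
- exists (fun _ => RtoC 0); split; [apply is_poly_const |].
  intros z; simpl; replace (r * 1 / 1) with r by field; ring.
- assert (h := has_jet_plus _ _ _ _ _ _ IH (has_jet_mult _ _ _ _ _ _
    (has_jet_const (r ^ (2 * S N + 1) / INR (2 * S N + 1)))
    (has_jet_pow _ _ _ (2 * S N) has_jet_id))).
  rewrite pow_i, (pow_i (2 * S N - 1)) in h by lia.
  replace (has_jet (artanh_poly r (S (S N))) r 0) with (has_jet (artanh_poly r (S (S N)))
    (r + r ^ (2 * S N + 1) / INR (2 * S N + 1) * 0) (0 + (r ^ (2 * S N + 1) / INR (2 * S N + 1) *
      (INR (2 * S N) * 0 * 1) + 0 * 0))) by (f_equal; ring).
  exact h.
Qed.

(** * From polynomials to the exponential of artanh *)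

Lemma is_RInt_unif_lim (fn : nat -> R -> R) (f : R -> R) (In eps : nat -> R) (a b I : R) :
  a <= b -> (forall n, is_RInt (fn n) a b (In n)) -> ex_RInt f a b ->
  (forall n x, a <= x <= b -> Rabs (fn n x - f x) <= eps n) ->
  is_lim_seq eps 0 -> is_lim_seq In I -> is_RInt f a b I.
Proof.
intros hab hfn hf heps leps lIn.
enough (e : RInt f a b = I) by (rewrite <- e; now apply (RInt_correct (V := R_CompleteNormedModule))).
assert (hle : forall n, Rabs (In n - RInt f a b) <= (b - a) * eps n).
{ intros n; rewrite <- (is_RInt_unique _ _ _ _ (hfn n)).
  assert (hn : ex_RInt (fn n) a b) by (now exists (In n)).
  rewrite <- (RInt_minus (V := R_CompleteNormedModule)) by assumption.
  apply abs_RInt_le_const; [easy | | now apply heps].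
  now apply (ex_RInt_minus (V := R_NormedModule)). }
assert (l0 : is_lim_seq (fun n => In n - RInt f a b) 0).
{ apply is_lim_seq_abs_0.
  apply (is_lim_seq_le_le (fun _ => 0) _ (fun n => (b - a) * eps n)).
  - intros n; split; [apply Rabs_pos | apply hle].
  - apply is_lim_seq_const.
  - replace (Finite 0) with (Rbar_mult (b - a) 0) by (simpl; f_equal; ring).
    now apply is_lim_seq_scal_l. }
assert (l1 := is_lim_seq_minus' _ _ _ _ lIn (is_lim_seq_const (RInt f a b))).
assert (e := is_lim_seq_unique _ _ l0); rewrite (is_lim_seq_unique _ _ l1) in e.
injection e; lra.
Qed.

Lemma is_lim_seq_INR_S : is_lim_seq (fun n => / INR (S n)) 0.
Proof.
apply (is_lim_seq_incr_1 (fun n => / INR n)).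
replace (Finite 0) with (Rbar_inv p_infty) by reflexivity.
apply is_lim_seq_inv; [apply is_lim_seq_INR | easy].
Qed.

Lemma is_lim_seq_euler_bound (K : R) (delta : nat -> R) : is_lim_seq delta 0 ->
  is_lim_seq (fun n => exp K * (5 * K ^ 2 / INR (S n) + delta n)) 0.
Proof.
intros hd.
replace (Finite 0) with (Finite (exp K * (5 * K ^ 2 * 0 + 0))) by (f_equal; ring).
apply (is_lim_seq_scal_l _ (exp K) (Finite _)).
apply is_lim_seq_plus'; [| easy].
apply (is_lim_seq_scal_l _ (5 * K ^ 2) (Finite _)), is_lim_seq_INR_S.
Qed.

Lemma eventually_INR_S_ge (K : R) : eventually (fun n => K <= INR (S n)).
Proof.
assert (h := is_lim_seq_incr_1 INR p_infty).
destruct h as [h _]; specialize (h is_lim_seq_INR).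
destruct (proj2 (is_lim_seq_spec _ _) h K) as [N hN]; exists N; intros n hn.
now apply Rlt_le, hN.
Qed.

(** The complex estimate [cexp_euler_bound] is reused on the real axis; the bound [Rabs l + 1]
    eventually dominates both [l] and [w n]. *)
Lemma is_lim_seq_exp (w : nat -> R) (l : R) : is_lim_seq w l ->
  is_lim_seq (fun n => (1 + / INR (S n) * w n) ^ S n) (exp l).
Proof.
intros hw.
assert (hd : is_lim_seq (fun n => Rabs (l - w n)) 0).
{ rewrite <- Rabs_R0; apply (is_lim_seq_abs _ (Finite 0)).
  replace (Finite 0) with (Finite (l - l)) by (f_equal; ring).
  apply is_lim_seq_minus'; [apply is_lim_seq_const | easy]. }
set (K := Rabs l + 1).
apply is_lim_seq_ext with (fun n => exp l - (exp l - (1 + / INR (S n) * w n) ^ S n));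
  [intros n; ring |].
replace (Finite (exp l)) with (Finite (exp l - 0)) by (f_equal; ring).
apply is_lim_seq_minus'; [apply is_lim_seq_const |].
apply is_lim_seq_abs_0.
apply (is_lim_seq_le_le_loc (fun _ => 0) _
  (fun n => exp K * (5 * K ^ 2 / INR (S n) + Rabs (l - w n)))).
- destruct (eventually_INR_S_ge (2 * K)) as [N1 h1].
  destruct (proj2 (is_lim_seq_spec _ _) hd (mkposreal 1 Rlt_0_1)) as [N2 h2].
  exists (N1 + N2)%nat; intros n hn; split; [apply Rabs_pos |].
  specialize (h1 n ltac:(lia)); specialize (h2 n ltac:(lia)); simpl in h2.
  rewrite Rminus_0_r, Rabs_Rabsolu in h2.
  assert (hb := cexp_euler_bound (RtoC l) (RtoC (w n)) K (Rabs (l - w n)) (S n)).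
  rewrite <- RtoC_minus, !Cmod_R in hb.
  assert (e : cexp (RtoC l) = RtoC (exp l))
    by (unfold cexp, RtoC; simpl; rewrite cos_0, sin_0; f_equal; ring).
  rewrite e, <- RtoC_mult, <- RtoC_plus, <- RtoC_pow, <- RtoC_minus, Cmod_R in hb.
  apply hb; [unfold K; lra | | lra | lia | easy].
  unfold K; revert h2; unfold Rabs; repeat destruct Rcase_abs; lra.
- apply is_lim_seq_const.
- now apply is_lim_seq_euler_bound.
Qed.

Lemma has_jet_affine (a b : R) : has_jet (fun z => RtoC a + RtoC b * z)%C a b.
Proof.
exists (fun _ => RtoC 0); split; [apply is_poly_const |]; intros z; ring.
Qed.

(* Polynomial approximation of [(1 - z)^2 exp ((1 + z)^2 artanh (r z) / z)]. *)
Definition stieltjes_poly (r : R) (n : nat) (z : C) : C :=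
  ((RtoC 1 + RtoC (-1) * z) ^ 2
   * (RtoC 1 + RtoC (/ INR n) * ((RtoC 1 + RtoC 1 * z) ^ 2 * artanh_poly r n z)) ^ n)%C.

Definition euler_pow (r : R) (n : nat) : R := (1 + / INR n * r) ^ n.

(** Logarithmic differentiation at 0: (1 - z)^2 contributes -2. The inner factor (1 + z)^2
    [artanh_poly] has jet r, 2r, so the n-th power contributes n (2r/n) / (1 + r/n). *)
Lemma has_jet_stieltjes_poly (r : R) (k : nat) : 0 < r ->
  has_jet (stieltjes_poly r (S k)) (euler_pow r (S k))
    (euler_pow r (S k) * (2 * r / (1 + / INR (S k) * r) - 2)).
Proof.
intros hr; unfold euler_pow; set (n := S k).
assert (hn : 0 < / INR n) by (apply Rinv_0_lt_compat, lt_0_INR; unfold n; lia).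
assert (h := has_jet_mult _ _ _ _ _ _ (has_jet_pow _ _ _ 2 (has_jet_affine 1 (-1)))
  (has_jet_pow _ _ _ n (has_jet_plus _ _ _ _ _ _ (has_jet_const 1)
    (has_jet_mult _ _ _ _ _ _ (has_jet_const (/ INR n))
      (has_jet_mult _ _ _ _ _ _ (has_jet_pow _ _ _ 2 (has_jet_affine 1 1))
        (has_jet_artanh_poly r k)))))).
match type of h with has_jet _ ?a ?b =>
  replace a with ((1 + / INR n * r) ^ n) in h by (simpl; rewrite !Rmult_1_l; reflexivity);
  replace b with ((1 + / INR n * r) ^ n * (2 * r / (1 + / INR n * r) - 2)) in h
end; [exact h |].
assert (hr1 : 0 < 1 + / INR n * r) by nra.
replace (1 ^ 2 * r) with r by ring.
replace (n - 1)%nat with k by (unfold n; lia).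
change ((1 + / INR n * r) ^ n) with ((1 + / INR n * r) * (1 + / INR n * r) ^ k).
assert (hn1 : INR n * / INR n = 1) by (apply Rinv_r; intros e; rewrite e, Rinv_0 in hn; lra).
replace (INR 2) with 2 by reflexivity.
transitivity ((1 + / INR n * r) ^ k * (2 * r) - 2 * ((1 + / INR n * r) * (1 + / INR n * r) ^ k)).
- generalize dependent (/ INR n); intros i; intros; field; lra.
- transitivity (INR n * / INR n * (1 + / INR n * r) ^ k * (2 * r)
    - 2 * ((1 + / INR n * r) * (1 + / INR n * r) ^ k)); [rewrite hn1; ring | simpl; ring].
Qed.

(* [Im (G / z)] at [z = e^{i th}], with [artanh z] replaced by [artanh (r z)] in [G]. *)
Definition boundary_term (r th : R) : R :=
  (2 * cos th - 2) * (exp ((2 + 2 * cos th) * artanh_re th r)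
                      * sin ((2 + 2 * cos th) * artanh_im th r)).

(** For |z| = 1 one has (1 - z)^2 / z = 2 cos th - 2 and (1 + z)^2 = (2 + 2 cos th) z. The first is
    real and leaves the imaginary part; the z in the second restores the artanh sum from
    [artanh_poly]. *)
Lemma stieltjes_poly_cis (r th : R) (n : nat) :
  Im (Cconj (cis th) * stieltjes_poly r n (cis th))
  = (2 * cos th - 2) * Im ((RtoC 1 + RtoC (/ INR n) * (RtoC (2 + 2 * cos th)
       * (artanh_sum cos th n r, artanh_sum sin th n r))) ^ n).
Proof.
rewrite <- artanh_poly_cis.
assert (e1 : (Cconj (cis th) * cis th)%C = RtoC 1).
{ unfold cis, Cconj, Cmult, RtoC; simpl; f_equal; [| ring].
  generalize (sin2_cos2 th); unfold Rsqr; lra. }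
assert (e2 : (cis th + Cconj (cis th))%C = RtoC (2 * cos th))
  by (unfold cis, Cconj, Cplus, RtoC; simpl; f_equal; ring).
unfold stieltjes_poly.
assert (e3 : ((RtoC 1 + RtoC 1 * cis th) ^ 2 * artanh_poly r n (cis th))%C
  = (RtoC (2 + 2 * cos th) * (cis th * artanh_poly r n (cis th)))%C).
{ rewrite RtoC_plus, <- e2.
  transitivity ((cis th * cis th + RtoC 2 * cis th + RtoC 1) * artanh_poly r n (cis th))%C;
    [simpl; ring | rewrite <- e1; ring]. }
rewrite e3; set (B := (_ ^ n)%C).
assert (e4 : (Cconj (cis th) * ((RtoC 1 + RtoC (-1) * cis th) ^ 2 * B))%C
  = (RtoC (2 * cos th - 2) * B)%C).
{ rewrite RtoC_minus, <- e2.
  transitivity (((Cconj (cis th) * cis th) * cis th - RtoC 2 * (Cconj (cis th) * cis th)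
    + Cconj (cis th)) * B)%C.
  { replace (RtoC (-1)) with (- RtoC 1)%C by (rewrite <- RtoC_opp; reflexivity); simpl; ring. }
  rewrite e1; ring. }
rewrite e4; unfold Im; simpl; ring.
Qed.

Lemma artanh_err_le (r : R) (n : nat) : Rabs r < 1 -> artanh_err r n <= artanh_err r 0.
Proof.
intros hr; assert (h := sqr_lt_1 r hr); generalize (pow2_ge_0 r); intros h0.
unfold artanh_err, Rdiv; apply Rmult_le_compat_r.
- apply Rlt_le, Rinv_0_lt_compat, pow_lt; lra.
- apply Rmult_le_compat_l; [lra |]; change ((r ^ 2) ^ 0) with 1.
  rewrite <- (pow1 n); apply pow_incr; lra.
Qed.

Lemma boundary_approx (r th : R) (n : nat) : Rabs r < 1 -> (1 <= n)%nat ->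
  2 * (16 * artanh_err r 0) <= INR n ->
  Rabs (Im (Cconj (cis th) * stieltjes_poly r n (cis th)) - boundary_term r th)
  <= 4 * (exp (16 * artanh_err r 0)
          * (5 * (16 * artanh_err r 0) ^ 2 / INR n + 8 * artanh_err r n)).
Proof.
intros hr hn1 hn; rewrite stieltjes_poly_cis; unfold boundary_term.
(* The factor 2 + 2 cos th is at most 4. The case N = 0 of the error bound controls the limit
   itself, so each component of a partial sum is at most 2 [artanh_err r 0]; two components give 4
   (2 + 2) = 16. *)
set (K := 16 * artanh_err r 0) in *.
set (z := (RtoC (2 + 2 * cos th) * (artanh_re th r, artanh_im th r))%C).
set (w := (RtoC (2 + 2 * cos th) * (artanh_sum cos th n r, artanh_sum sin th n r))%C).
assert (ez : exp ((2 + 2 * cos th) * artanh_re th r) * sin ((2 + 2 * cos th) * artanh_im th r)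
  = Im (cexp z)).
{ unfold cexp, z, Im, Re; simpl; f_equal; f_equal; ring. }
rewrite ez, <- Rmult_minus_distr_l, Rabs_mult.
destruct (COS_bound th) as [hc1 hc2].
apply Rmult_le_compat; try apply Rabs_pos.
{ rewrite Rabs_left1; lra. }
rewrite Rabs_minus_sym.
match goal with |- Rabs (Im ?a - Im ?b) <= _ =>
  replace (Im a - Im b) with (Im (a - b)) by (unfold Im; simpl; ring) end.
eapply Rle_trans; [apply im_le_Cmod |].
assert (hs : forall x y, Cmod (RtoC (2 + 2 * cos th) * (x, y)) <= 4 * (Rabs x + Rabs y)).
{ intros x y; rewrite Cmod_mult, Cmod_R, Rabs_pos_eq by lra.
  generalize (Cmod_le_Rabs_Rabs (x, y)) (Cmod_ge_0 (x, y)); simpl; intros.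
  apply Rmult_le_compat; lra. }
assert (hx := artanh_sum_cos_bound th r n hr).
assert (hy := artanh_sum_sin_bound th r n hr).
assert (hx0 := artanh_sum_cos_bound th r 0 hr).
assert (hy0 := artanh_sum_sin_bound th r 0 hr).
simpl artanh_sum in hx0, hy0; rewrite Rminus_0_l, Rabs_Ropp in hx0, hy0.
assert (he := artanh_err_le r n hr).
assert (he0 : 0 <= artanh_err r 0) by (generalize (Rabs_pos (artanh_re th r)); lra).
apply cexp_euler_bound; [| | | easy | easy].
- eapply Rle_trans; [apply hs |]; unfold K; lra.
- eapply Rle_trans; [apply hs |].
  assert (Rabs (artanh_sum cos th n r) <= 2 * artanh_err r 0)
    by (revert hx hx0; unfold Rabs; repeat destruct Rcase_abs; lra).
  assert (Rabs (artanh_sum sin th n r) <= 2 * artanh_err r 0)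
    by (revert hy hy0; unfold Rabs; repeat destruct Rcase_abs; lra).
  unfold K; lra.
- replace (z - w)%C with (RtoC (2 + 2 * cos th) *
    (artanh_re th r - artanh_sum cos th n r, artanh_im th r - artanh_sum sin th n r)%R)%C
    by (unfold z, w, Cminus, Cplus, Copp, Cmult; simpl; f_equal; ring).
  eapply Rle_trans; [apply hs |].
  rewrite (Rabs_minus_sym (artanh_re th r)), (Rabs_minus_sym (artanh_im th r)); lra.
Qed.

Lemma stieltjes_poly_real (r q : R) (n : nat) : q <> 0 ->
  Re (stieltjes_poly r n (RtoC q))
  = (1 - q) ^ 2 * (1 + / INR n * ((1 + q) ^ 2 / q * artanh_sum cos 0 n (r * q))) ^ n.
Proof.
intros hq.
assert (e : artanh_poly r n (RtoC q) = RtoC (artanh_sum cos 0 n (r * q) / q)).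
{ transitivity (RtoC (/ q) * (RtoC q * artanh_poly r n (RtoC q)))%C.
  - destruct (artanh_poly r n (RtoC q)) as [x y].
    unfold Cmult, RtoC; simpl; f_equal; field; easy.
  - rewrite artanh_poly_real, <- RtoC_mult; f_equal; unfold Rdiv; ring. }
unfold stieltjes_poly; rewrite e.
repeat (rewrite <- RtoC_mult || rewrite <- RtoC_plus || rewrite <- RtoC_pow).
unfold Re, RtoC; simpl fst; f_equal; [ring |].
apply (f_equal (fun x => x ^ n)); unfold Rdiv; ring.
Qed.

Lemma is_lim_seq_incr (u : nat -> R) (l : Rbar) : is_lim_seq u l -> is_lim_seq (fun n => u (S n)) l.
Proof. apply is_lim_seq_incr_1. Qed.

Lemma is_lim_seq_artanh_sum (r : R) : Rabs r < 1 ->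
  is_lim_seq (fun n => artanh_sum cos 0 n r) (artanh_re 0 r).
Proof.
intros hr.
apply is_lim_seq_ext with (fun n => artanh_re 0 r + (artanh_sum cos 0 n r - artanh_re 0 r));
  [intros n; ring |].
replace (Finite (artanh_re 0 r)) with (Finite (artanh_re 0 r + 0)) by (f_equal; ring).
apply is_lim_seq_plus'; [apply is_lim_seq_const |].
apply is_lim_seq_abs_0.
apply (is_lim_seq_le_le (fun _ => 0) _ (artanh_err r)).
- intros n; split; [apply Rabs_pos | now apply artanh_sum_cos_bound].
- apply is_lim_seq_const.
- now apply is_lim_seq_artanh_err.
Qed.

(** The right side of [is_RInt_jet] after n tends to infinity: the jet becomes exp r, exp r (2r -
    2), whose second entry vanishes at r = 1. *)
Definition boundary_value (r q : R) : R :=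
  PI / 2 * (((1 - q) ^ 2 * exp ((1 + q) ^ 2 / q * artanh_re 0 (r * q)) - exp r
             - exp r * (2 * r - 2) * q) / q ^ 2 - exp r).

Lemma is_RInt_boundary (r q : R) : 0 < r < 1 -> Rabs q < 1 -> q <> 0 ->
  is_RInt (fun th => boundary_term r th * sin th / poisson_den q th) 0 PI (boundary_value r q).
Proof.
intros hr hq hq0.
assert (hr1 : Rabs r < 1) by (rewrite Rabs_pos_eq; lra).
assert (hr2 := sqr_lt_1 r hr1).
assert (hrq : Rabs (r * q) < 1).
{ rewrite Rabs_mult, (Rabs_pos_eq r) by lra; generalize (Rabs_pos q); nra. }
(* [boundary_approx] applies only to large n. Shifting every sequence by [N] makes its bound valid
   at all indices, as [is_RInt_unif_lim] demands. *)
destruct (eventually_INR_S_ge (2 * (16 * artanh_err r 0))) as [N hN].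
set (K := 16 * artanh_err r 0) in *.
set (eps := fun n => 4 * (exp K * (5 * K ^ 2 / INR (S n) + 8 * artanh_err r (S n)))
   * / (1 - Rabs q) ^ 2).
set (b0 := fun n => euler_pow r (S n)).
set (b1 := fun n => b0 n * (2 * r / (1 + / INR (S n) * r) - 2)).
set (c := fun n => PI / 2 * ((Re (stieltjes_poly r (S n) (RtoC q)) - b0 n - b1 n * q) / q ^ 2 - b0 n)).
assert (hden : 0 < (1 - Rabs q) ^ 2) by (apply pow_lt; lra).
apply (is_RInt_unif_lim
  (fun n th => Im (Cconj (cis th) * stieltjes_poly r (S (n + N)) (cis th)) * sin th / poisson_den q th) _
  (fun n => c (n + N)%nat) (fun n => eps (n + N)%nat)).
- apply Rlt_le, PI_RGT_0.
- intros n; unfold c, b1, b0; apply is_RInt_jet; [| easy | easy].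
  apply has_jet_stieltjes_poly; lra.
- apply ex_RInt_of_ex_derive; intros th.
  unfold boundary_term, artanh_re, artanh_im.
  generalize (poisson_den_pos q th hq) (poisson_den_pos r th hr1)
    (poisson_den_pos (- r) th ltac:(now rewrite Rabs_Ropp)).
  unfold poisson_den; intros; auto_derive; repeat split; simpl in *; lra.
- intros n th _; unfold eps, Rdiv.
  rewrite <- !Rmult_minus_distr_r, !Rabs_mult.
  assert (hs : Rabs (sin th) <= 1) by (apply Rabs_le, SIN_bound).
  generalize (poisson_den_pos q th hq) (poisson_den_ge q th); intros hd0 hd1.
  assert (hi : 0 < / poisson_den q th) by now apply Rinv_0_lt_compat.
  apply Rmult_le_compat; try apply Rabs_pos.
  + apply Rmult_le_pos; apply Rabs_pos.
  + rewrite <- (Rmult_1_r (4 * _)).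
    apply Rmult_le_compat; try apply Rabs_pos; [| easy].
    apply boundary_approx; [easy | lia |]; apply hN; lia.
  + rewrite Rabs_pos_eq by lra; now apply Rinv_le_contravar.
- apply (is_lim_seq_incr_n eps N).
  replace (Finite 0) with (Finite (4 * 0 * / (1 - Rabs q) ^ 2)) by (f_equal; ring).
  apply (is_lim_seq_scal_r _ _ (Finite _)), (is_lim_seq_scal_l _ _ (Finite _)).
  apply is_lim_seq_euler_bound.
  replace (Finite 0) with (Finite (8 * 0)) by (f_equal; ring).
  apply (is_lim_seq_scal_l _ _ (Finite _)), (is_lim_seq_incr (artanh_err r)).
  now apply is_lim_seq_artanh_err.
- apply (is_lim_seq_incr_n c N); unfold boundary_value, c.
  assert (l0 : is_lim_seq b0 (exp r)) by (apply is_lim_seq_exp, is_lim_seq_const).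
  assert (l1 : is_lim_seq b1 (exp r * (2 * r - 2))).
  { unfold b1; apply is_lim_seq_mult'; [easy |].
    apply is_lim_seq_minus'; [| apply is_lim_seq_const].
    replace (Finite (2 * r)) with (Finite (2 * r / (1 + 0 * r))) by (f_equal; field).
    apply is_lim_seq_div'; [apply is_lim_seq_const | | lra].
    apply is_lim_seq_plus'; [apply is_lim_seq_const |].
    apply is_lim_seq_mult'; [apply is_lim_seq_INR_S | apply is_lim_seq_const]. }
  apply is_lim_seq_mult'; [apply is_lim_seq_const |].
  apply is_lim_seq_minus'; [| easy].
  apply is_lim_seq_mult'; [| apply is_lim_seq_const].
  apply is_lim_seq_minus'; [| apply is_lim_seq_mult'; [easy | apply is_lim_seq_const]].
  apply is_lim_seq_minus'; [| easy].
  apply is_lim_seq_ext with (fun n => (1 - q) ^ 2 * (1 + / INR (S n) * ((1 + q) ^ 2 / q *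
    artanh_sum cos 0 (S n) (r * q))) ^ S n).
  { intros n; now rewrite stieltjes_poly_real. }
  apply is_lim_seq_mult'; [apply is_lim_seq_const |].
  apply is_lim_seq_exp, is_lim_seq_mult'; [apply is_lim_seq_const |].
  apply (is_lim_seq_incr (fun n => artanh_sum cos 0 n (r * q))).
  now apply is_lim_seq_artanh_sum.
Qed.

(** * Passing to the unit circle *)

Lemma ln_le_sub_1 (x : R) : 0 < x -> ln x <= x - 1.
Proof. intros hx; generalize (exp_ineq1_le (ln x)); rewrite exp_ln by easy; lra. Qed.

Lemma ln_nonpos (x : R) : 0 < x <= 1 -> ln x <= 0.
Proof. intros hx; generalize (ln_le_sub_1 x); lra. Qed.

Lemma exp_le_compat (x y : R) : x <= y -> exp x <= exp y.
Proof. intros [h | h]; [now apply Rlt_le, exp_increasing | rewrite h; lra]. Qed.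

(* [k] compensates exponentials that are large where [k] is small. *)
Lemma Rabs_exp_sub_le (a b M k : R) : 0 <= k -> k * exp a <= M -> k * exp b <= M ->
  k * Rabs (exp a - exp b) <= M * Rabs (a - b).
Proof.
assert (H : forall a b, 0 <= k -> k * exp a <= M -> b <= a ->
  k * Rabs (exp a - exp b) <= M * Rabs (a - b)).
{ intros x y hk hx hxy; rewrite !Rabs_pos_eq; [| lra | generalize (exp_le_compat y x hxy); lra].
  replace (exp y) with (exp x * exp (y - x)) by (rewrite <- exp_plus; f_equal; ring).
  generalize (exp_ineq1_le (y - x)) (exp_pos x); intros h1 h2.
  assert (exp x * (1 - exp (y - x)) <= exp x * (x - y)) by (apply Rmult_le_compat_l; lra).
  apply (Rle_trans _ (k * (exp x * (x - y)))); [apply Rmult_le_compat_l; [easy | lra] |].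
  rewrite <- Rmult_assoc; apply Rmult_le_compat_r; lra. }
intros hk ha hb; destruct (Rle_dec b a) as [h | h]; [now apply H |].
rewrite (Rabs_minus_sym (exp a)), (Rabs_minus_sym a); apply H; lra.
Qed.

Lemma Rabs_ln_sub_le (u v : R) : 1 / 2 <= u -> 1 / 2 <= v -> Rabs (ln u - ln v) <= 2 * Rabs (u - v).
Proof.
assert (H : forall u v, 1 / 2 <= v -> v <= u -> Rabs (ln u - ln v) <= 2 * Rabs (u - v)).
{ intros x y hy hxy; rewrite !Rabs_pos_eq; [| lra | generalize (ln_le y x); lra].
  rewrite <- ln_div by lra.
  apply (Rle_trans _ (x / y - 1)); [apply ln_le_sub_1, Rdiv_lt_0_compat; lra |].
  replace (x / y - 1) with ((x - y) * / y) by (field; lra).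
  rewrite Rmult_comm; apply Rmult_le_compat_r; [lra |].
  replace 2 with (/ (1 / 2)) by field; apply Rinv_le_contravar; lra. }
intros hu hv; destruct (Rle_dec v u) as [h | h]; [now apply H |].
rewrite (Rabs_minus_sym (ln u)), (Rabs_minus_sym u); apply H; lra.
Qed.

Lemma atan_bound (x : R) : 0 <= x -> 0 <= atan x <= x.
Proof.
intros hx; split.
- destruct hx as [hx | hx]; [| rewrite <- hx, atan_0; lra].
  rewrite <- atan_0; now apply Rlt_le, atan_increasing.
- generalize (lipschitz_of_derive atan (fun x => / (1 + x ^ 2)) 0 x 1).
  rewrite atan_0, !Rminus_0_r, (Rabs_pos_eq x), Rmult_1_l by easy; intros h.
  apply (Rle_trans _ (Rabs (atan x))); [apply Rle_abs |]; apply h.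
  + intros z _; replace (z ^ 2) with (Rsqr z) by (unfold Rsqr; ring); apply is_derive_atan.
  + intros z _; generalize (pow2_ge_0 z); intros hz.
    rewrite Rabs_pos_eq by (apply Rlt_le, Rinv_0_lt_compat; lra).
    rewrite <- Rinv_1 at 2; apply Rinv_le_contravar; lra.
Qed.

Lemma g_interior (s : R) : 0 < s < 1 ->
  PI * g s = (1 - s) * exp (s * (ln s - ln (1 - s))) * sin (PI * s).
Proof.
intros hs; unfold g, Rpower.
assert (hp := PI_RGT_0).
rewrite <- exp_plus.
replace (s * ln s + (1 - s) * ln (1 - s)) with (ln (1 - s) + s * (ln s - ln (1 - s))) by ring.
rewrite exp_plus, exp_ln by lra; field; lra.
Qed.

(* With [eta = (1 - r) / sin th], the exponents differ by O(eta^2) and the phases by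
   O(eta), while both terms are bounded; the factor [sin th] absorbs [eta]. *)
Lemma boundary_term_near (r th : R) : 1 / 2 <= r < 1 -> 0 < th < PI ->
  Rabs (boundary_term r th + 4 * (PI * g ((1 + cos th) / 2))) * sin th <= 32 * (1 - r).
Proof.
intros hr hth.
assert (hsin : 0 < sin th) by now apply sin_gt_0.
set (s := (1 + cos th) / 2).
set (e := 1 - r).
assert (hsq := sin_sqr th).
assert (hc : -1 < cos th < 1) by nra.
assert (hs : 0 < s < 1) by (unfold s; lra).
assert (hcs : cos th = 2 * s - 1) by (unfold s; field).
assert (hss : sin th ^ 2 = 4 * (s * (1 - s))) by (rewrite hsq, hcs; ring).
rewrite (g_interior s hs); unfold boundary_term.
set (b := (2 + 2 * cos th) * artanh_im th r).
set (a := (2 + 2 * cos th) * artanh_re th r).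
set (a1 := s * (ln s - ln (1 - s))).
set (b1 := PI * s).
assert (ea : a = s * (ln (poisson_den (- r) th) - ln (poisson_den r th)))
  by (unfold a, artanh_re; rewrite hcs; field).
assert (eP : poisson_den (- r) th = e ^ 2 + 4 * r * s)
  by (unfold poisson_den, e; rewrite hcs; ring).
assert (eM : poisson_den r th = e ^ 2 + 4 * r * (1 - s))
  by (unfold poisson_den, e; rewrite hcs; ring).
assert (he : 0 < e <= 1 / 2) by (unfold e; lra).
assert (he2 : 0 < e ^ 2) by (apply pow_lt; lra).
assert (ha1 : (1 - s) * exp a1 <= 2).
{ replace (1 - s) with (exp (ln (1 - s))) at 1 by (rewrite exp_ln; lra).
  rewrite <- exp_plus; apply (Rle_trans _ (exp 0)); [| rewrite exp_0; lra].
  apply exp_le_compat; unfold a1.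
  generalize (ln_nonpos s) (ln_nonpos (1 - s)); intros h1 h2.
  specialize (h1 ltac:(lra)); specialize (h2 ltac:(lra)); nra. }
(* The numerator kernel is at most 4 and the denominator kernel at least 2 (1 - s), so the left side
   is at most (1 - s)^(1-s) 2^s. *)
assert (ha : (1 - s) * exp a <= 2).
{ replace (1 - s) with (exp (ln (1 - s))) at 1 by (rewrite exp_ln; lra).
  rewrite <- exp_plus; apply (Rle_trans _ (exp (ln 2))); [| rewrite exp_ln; lra].
  apply exp_le_compat; rewrite ea, eP, eM.
  assert (h1 : ln (e ^ 2 + 4 * r * s) <= ln (2 * 2)).
  { apply ln_le; [nra |]; unfold e; nra. }
  assert (h2 : ln (2 * (1 - s)) <= ln (e ^ 2 + 4 * r * (1 - s))) by (apply ln_le; nra).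
  rewrite (ln_mult 2 2) in h1 by lra.
  rewrite ln_mult in h2 by lra.
  generalize (ln_nonpos (1 - s) ltac:(lra)) (ln_le 1 2 ltac:(lra) ltac:(lra)).
  rewrite ln_1; intros h3 h4.
  apply (Rle_trans _ (ln (1 - s) + s * (ln 2 - ln (1 - s)))).
  2:{ assert (0 <= (1 - s) * (ln 2 - ln (1 - s))) by (apply Rmult_le_pos; lra); lra. }
  apply Rplus_le_compat_l, Rmult_le_compat_l; lra. }
(* If sin th <= 1 - r, boundedness of both terms already suffices. Otherwise eta < 1 and the terms
   are compared. *)
destruct (Rle_dec (sin th) e) as [hcase | hcase].
- assert (hb : Rabs ((2 * cos th - 2) * (exp a * sin b) + 4 * ((1 - s) * exp a1 * sin b1)) <= 16).
  { replace (2 * cos th - 2) with (- 4 * (1 - s)) by (rewrite hcs; ring).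
    eapply Rle_trans; [apply Rabs_triang |].
    assert (H : forall x y, 0 <= x <= 2 -> Rabs (x * sin y) <= 2).
    { intros x y hx; rewrite Rabs_mult, Rabs_pos_eq by lra.
      assert (Rabs (sin y) <= 1) by (apply Rabs_le, SIN_bound).
      generalize (Rabs_pos (sin y)); nra. }
    replace (-4 * (1 - s) * (exp a * sin b)) with ((-4) * (((1 - s) * exp a) * sin b)) by ring.
    rewrite !(Rabs_mult (-4)), !(Rabs_mult 4), (Rabs_left (-4)), (Rabs_pos_eq 4) by lra.
    generalize (H ((1 - s) * exp a) b) (H ((1 - s) * exp a1) b1) (exp_pos a) (exp_pos a1).
    intros h1 h2 h3 h4.
    specialize (h1 ltac:(split; [apply Rmult_le_pos; lra | lra])).
    specialize (h2 ltac:(split; [apply Rmult_le_pos; lra | lra])); lra. }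
  generalize (Rabs_pos ((2 * cos th - 2) * (exp a * sin b) + 4 * ((1 - s) * exp a1 * sin b1))).
  intros; nra.
- set (eta := e / sin th).
  assert (heta : 0 < eta <= 1).
  { unfold eta; split; [apply Rdiv_lt_0_compat; lra |].
    apply Rle_div_l; lra. }
  assert (eeta : eta * sin th = e) by (unfold eta; field; lra).
  assert (hk : forall x, 0 < x <= 1 -> 4 * (s * (1 - s)) <= 4 * x -> 0 <= e ^ 2 / (4 * x) <= eta).
  { intros x hx hxs; split; [apply Rmult_le_pos; [lra |]; apply Rlt_le, Rinv_0_lt_compat; lra |].
    apply Rle_div_l; [lra |].
    rewrite <- hss in hxs; rewrite <- eeta.
    apply (Rle_trans _ (eta * sin th ^ 2)); [| apply Rmult_le_compat_l; lra].
    generalize (pow2_ge_0 (sin th)); nra. }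
  assert (hk1 := hk s ltac:(lra) ltac:(nra)).
  assert (hk2 := hk (1 - s) ltac:(lra) ltac:(nra)).
  (* Extracting 4 s and 4 (1 - s) from the two kernels isolates the logarithms of [a1]. The
     remaining arguments are r plus perturbations in [0, eta], because sin^2 th = 4 s (1 - s); they
     are at least 1/2, where ln is 2-Lipschitz. *)
  assert (hab : Rabs (a - a1) <= 2 * eta).
  { replace (a - a1) with (s * (ln (r + e ^ 2 / (4 * s)) - ln (r + e ^ 2 / (4 * (1 - s))))).
    2:{ rewrite ea, eP, eM; unfold a1.
        replace (e ^ 2 + 4 * r * s) with ((4 * s) * (r + e ^ 2 / (4 * s))) by (field; lra).
        replace (e ^ 2 + 4 * r * (1 - s)) with ((4 * (1 - s)) * (r + e ^ 2 / (4 * (1 - s))))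
          by (field; lra).
        rewrite (ln_mult (4 * s)), (ln_mult (4 * (1 - s))) by lra.
        rewrite (ln_mult 4 s), (ln_mult 4 (1 - s)) by lra; ring. }
    rewrite Rabs_mult, Rabs_pos_eq by lra.
    eapply Rle_trans; [apply Rmult_le_compat_l; [lra | apply Rabs_ln_sub_le; lra] |].
    match goal with |- s * (2 * Rabs ?x) <= _ => assert (Rabs x <= eta) end.
    { apply Rabs_le; lra. }
    match goal with |- s * (2 * Rabs ?x) <= _ => generalize (Rabs_pos x); intros end; nra. }
  (* With T = (1 - r^2) / (2 r sin th), the identity atan(1/T) = PI/2 - atan T turns [b] into PI s -
     2 s atan T, and T <= 2 eta. *)
  assert (hbb : Rabs (b - b1) <= 4 * eta).
  { assert (hT : 0 < (1 - r ^ 2) / (2 * r * sin th)).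
    { apply Rdiv_lt_0_compat; [unfold e in *; nra |]; apply Rmult_lt_0_compat; lra. }
    assert (hT1 : (1 - r ^ 2) / (2 * r * sin th) <= 2 * eta).
    { apply Rle_div_l; [apply Rmult_lt_0_compat; lra |].
      replace (2 * eta * (2 * r * sin th)) with (4 * r * (eta * sin th)) by ring.
      rewrite eeta; unfold e; nra. }
    assert (eT : 2 * r * sin th / (1 - r ^ 2) = / ((1 - r ^ 2) / (2 * r * sin th))).
    { field; unfold e in *; repeat split; nra. }
    assert (eb : b - b1 = - (2 * s * atan ((1 - r ^ 2) / (2 * r * sin th)))).
    { unfold b, b1, artanh_im; rewrite eT, atan_inv by easy; rewrite hcs; field. }
    generalize (atan_bound _ (Rlt_le _ _ hT)); intros hat.
    rewrite eb, Rabs_Ropp, Rabs_pos_eq; nra. }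
  replace ((2 * cos th - 2) * (exp a * sin b) + 4 * ((1 - s) * exp a1 * sin b1))
    with (- 4 * ((1 - s) * (exp a - exp a1) * sin b + (1 - s) * exp a1 * (sin b - sin b1)))
    by (rewrite hcs; ring).
  rewrite Rabs_mult, (Rabs_left (-4)) by lra.
  assert (h1 : Rabs ((1 - s) * (exp a - exp a1) * sin b) <= 4 * eta).
  { rewrite !Rabs_mult, (Rabs_pos_eq (1 - s)) by lra.
    assert (Rabs (sin b) <= 1) by (apply Rabs_le, SIN_bound).
    generalize (Rabs_exp_sub_le a a1 2 (1 - s) ltac:(lra) ha ha1) (Rabs_pos (sin b)); intros.
    assert (0 <= (1 - s) * Rabs (exp a - exp a1)) by (apply Rmult_le_pos; [lra | apply Rabs_pos]).
    nra. }
  assert (h2 : Rabs ((1 - s) * exp a1 * (sin b - sin b1)) <= 4 * eta).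
  { rewrite Rabs_mult, Rabs_pos_eq
      by (apply Rmult_le_pos; [lra | apply Rlt_le, exp_pos]).
    assert (h3 : (1 - s) * exp a1 <= 1).
    { replace (1 - s) with (exp (ln (1 - s))) at 1 by (rewrite exp_ln; lra).
      rewrite <- exp_plus; apply (Rle_trans _ (exp 0)); [| rewrite exp_0; lra].
      apply exp_le_compat; unfold a1.
      generalize (ln_nonpos s ltac:(lra)) (ln_nonpos (1 - s) ltac:(lra)); intros; nra. }
    generalize (Rabs_sin_minus_le b1 b) (Rabs_pos (sin b - sin b1)); intros; nra. }
  assert (h3 := Rabs_triang ((1 - s) * (exp a - exp a1) * sin b) ((1 - s) * exp a1 * (sin b - sin b1))).
  apply (Rle_trans _ (32 * eta * sin th)); [apply Rmult_le_compat_r; lra |].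
  rewrite Rmult_assoc, eeta; lra.
Qed.

(** Since [ln] is 0 on nonpositive arguments, the delicate point is 0. Continuity there makes [g]
    continuous at 0 and 1 too, where [Rpower 0 0] is 1, so [g] times a continuous factor is
    integrable on [0, 1]. *)
Lemma continuous_mul_ln (x : R) : continuous (fun x => x * ln x) x.
Proof.
destruct (Rtotal_order x 0) as [hx | [hx | hx]].
- apply (continuous_ext_loc (T := R_UniformSpace) (U := R_UniformSpace) _ (fun _ => 0)).
  + apply (locally_interval _ _ m_infty 0); [easy | easy |].
    intros y _ hy; simpl in hy; unfold ln; destruct (Rlt_dec 0 y); [exfalso; lra | now rewrite Rmult_0_r].
  + apply continuous_const.
- rewrite hx; apply continuity_pt_filterlim; intros eps heps.
  (* With t = sqrt y, y ln y = 2 t (t ln t) and |t ln t| <= 1 for t <= 1, so it is enough that 2 t <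
     eps. *)
  exists (Rmin 1 ((eps / 2) ^ 2)); split.
  { apply Rmin_pos; [lra |]; apply pow_lt; lra. }
  intros y [_ hy]; simpl in *; unfold R_dist, Rdist in *.
  rewrite Rminus_0_r in hy; rewrite Rmult_0_l, Rminus_0_r.
  destruct (Rle_dec y 0) as [h0 | h0].
  { unfold ln; destruct (Rlt_dec 0 y); [exfalso; lra |]; now rewrite Rmult_0_r, Rabs_R0. }
  rewrite (Rabs_pos_eq y) in hy by lra.
  assert (hy1 := Rlt_le_trans _ _ _ hy (Rmin_l _ _)).
  assert (hy2 := Rlt_le_trans _ _ _ hy (Rmin_r _ _)).
  set (t := sqrt y).
  assert (ht : 0 < t) by (apply sqrt_lt_R0; lra).
  assert (ety : t * t = y) by (apply sqrt_sqrt; lra).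
  assert (hle : t < eps / 2) by nra.
  rewrite <- ety, ln_mult by easy.
  assert (hi : t * ln (/ t) <= 1).
  { assert (h1 : 0 < / t) by now apply Rinv_0_lt_compat.
    generalize (ln_le_sub_1 _ h1); intros h2.
    assert (t * / t = 1) by (apply Rinv_r; lra); nra. }
  rewrite ln_Rinv in hi by easy.
  assert (hn : ln t <= 0) by (apply ln_nonpos; nra).
  rewrite Rabs_left1; nra.
- apply (ex_derive_continuous (V := R_NormedModule)); auto_derive; easy.
Qed.

Lemma continuous_g (s : R) : continuous g s.
Proof.
assert (h : forall s, continuous (fun s => Rpower s s) s).
{ intros x; unfold Rpower; apply (continuous_comp (fun x => x * ln x) exp).
  - apply continuous_mul_ln.
  - apply (ex_derive_continuous (V := R_NormedModule)); auto_derive; easy. }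
unfold g; apply (continuous_scal_r (V := R_NormedModule) (1 / PI)).
apply (continuous_mult (K := R_AbsRing)).
- apply (continuous_mult (K := R_AbsRing)); [apply h |].
  apply (continuous_comp (fun s => 1 - s) (fun s => Rpower s s)); [| apply h].
  apply (ex_derive_continuous (V := R_NormedModule)); auto_derive; easy.
- apply (ex_derive_continuous (V := R_NormedModule)); auto_derive; easy.
Qed.

Lemma is_RInt_boundary_limit (q : R) : Rabs q < 1 -> q <> 0 ->
  is_RInt (fun th => - 4 * PI * g ((1 + cos th) / 2) * sin th / poisson_den q th) 0 PI
    (boundary_value 1 q).
Proof.
intros hq hq0.
(* Starting the denominators at 2 keeps r n >= 1/2, the range of [boundary_term_near]. *)
set (r := fun n => 1 - / INR (S (S n))).
assert (hr : forall n, 1 / 2 <= r n < 1).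
{ intros n; unfold r.
  assert (h : 2 <= INR (S (S n))) by (change 2 with (INR 2); apply le_INR; lia).
  assert (/ INR (S (S n)) <= / 2) by (apply Rinv_le_contravar; lra).
  assert (0 < / INR (S (S n))) by (apply Rinv_0_lt_compat; lra); lra. }
assert (lr : is_lim_seq r 1).
{ unfold r; replace (Finite 1) with (Finite (1 - 0)) by (f_equal; ring).
  apply is_lim_seq_minus'; [apply is_lim_seq_const |].
  apply (is_lim_seq_incr (fun n => / INR (S n))), is_lim_seq_INR_S. }
assert (hden : 0 < (1 - Rabs q) ^ 2) by (apply pow_lt; lra).
apply (is_RInt_unif_lim (fun n th => boundary_term (r n) th * sin th / poisson_den q th) _
  (fun n => boundary_value (r n) q) (fun n => 32 * (1 - r n) * / (1 - Rabs q) ^ 2)).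
- apply Rlt_le, PI_RGT_0.
- intros n; apply is_RInt_boundary; [| easy | easy]; generalize (hr n); lra.
- apply (ex_RInt_continuous (V := R_CompleteNormedModule)); intros th _.
  apply (continuous_ext (T := R_UniformSpace)
    (fun th => g ((1 + cos th) / 2) * (- 4 * PI * sin th / poisson_den q th))).
  { intros x; change (g ((1 + cos x) / 2) * (- 4 * PI * sin x / poisson_den q x)
      = - 4 * PI * g ((1 + cos x) / 2) * sin x / poisson_den q x).
    unfold Rdiv; ring. }
  apply (continuous_mult (K := R_AbsRing)).
  + apply (continuous_comp (fun th => (1 + cos th) / 2) g); [| apply continuous_g].
    apply (ex_derive_continuous (V := R_NormedModule)); auto_derive; easy.
  + apply (ex_derive_continuous (V := R_NormedModule)).
    generalize (poisson_den_pos q th hq); unfold poisson_den; intros; auto_derive; lra.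
- intros n th hth.
  generalize (poisson_den_pos q th hq) (poisson_den_ge q th); intros hd0 hd1.
  assert (hi : 0 < / poisson_den q th) by now apply Rinv_0_lt_compat.
  unfold Rdiv; rewrite <- !Rmult_minus_distr_r.
  replace (boundary_term (r n) th - -4 * PI * g ((1 + cos th) * / 2))
    with (boundary_term (r n) th + 4 * (PI * g ((1 + cos th) / 2))) by (unfold Rdiv; ring).
  rewrite Rabs_mult, (Rabs_pos_eq (/ _)) by lra.
  apply Rmult_le_compat; [apply Rabs_pos | lra | | now apply Rinv_le_contravar].
  generalize (hr n); intros hrn.
  assert (hs : 0 <= sin th) by (apply sin_ge_0; lra).
  rewrite Rabs_mult, (Rabs_pos_eq (sin th)) by easy.
  destruct hs as [hs | hs]; [| rewrite <- hs; lra].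
  apply boundary_term_near; [easy |].
  split; destruct hth as [[h1 | h1] [h2 | h2]]; try easy; subst; rewrite ?sin_0, ?sin_PI in hs; lra.
- replace (Finite 0) with (Finite (32 * (1 - 1) * / (1 - Rabs q) ^ 2)) by (f_equal; ring).
  apply is_lim_seq_mult'; [| apply is_lim_seq_const].
  apply is_lim_seq_mult'; [apply is_lim_seq_const |].
  apply is_lim_seq_minus'; [apply is_lim_seq_const | easy].
- apply (is_lim_seq_continuous (fun r => boundary_value r q)); [| easy].
  apply continuity_pt_filterlim, (ex_derive_continuous (V := R_NormedModule) (fun r => boundary_value r q) 1).
  generalize (poisson_den_pos q 0 hq) (poisson_den_pos (- q) 0 ltac:(now rewrite Rabs_Ropp)).
  unfold boundary_value, artanh_re, poisson_den; rewrite cos_0; intros h1 h2.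
  auto_derive; repeat split; try easy; simpl in *; nra.
Qed.

(** * The Stieltjes representation *)

Lemma ex_RInt_g_mult (h : R -> R) : (forall s, 0 <= s <= 1 -> continuous h s) ->
  ex_RInt (fun s => h s * g s) 0 1.
Proof.
intros hh; apply (ex_RInt_continuous (V := R_CompleteNormedModule)); intros s hs.
rewrite Rmin_left, Rmax_right in hs by lra.
apply (continuous_mult (K := R_AbsRing)); [now apply hh | apply continuous_g].
Qed.

Lemma is_RInt_stieltjes (x : R) : 0 < x ->
  is_RInt (fun s => / (x + s) * g s) 0 1
    ((x + 1) * (exp 1 - Rpower (1 + 1 / x) x) - exp 1 / 2).
Proof.
intros hx.
(* [p] is the root in (0, 1) of (1 - p)^2 = 4 p x, so q = -p inverts x = -(1 + q)^2 / (4 q). *)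
set (u := sqrt x); set (v := sqrt (x + 1)); set (p := (v - u) ^ 2).
assert (hu : 0 < u) by now apply sqrt_lt_R0.
assert (hv : 0 < v) by (apply sqrt_lt_R0; lra).
assert (eu : u * u = x) by (apply sqrt_sqrt; lra).
assert (ev : v * v = x + 1) by (apply sqrt_sqrt; lra).
assert (huv : 0 < v - u < 1) by (split; nra).
assert (hp : 0 < p < 1) by (unfold p; split; nra).
assert (e1 : (1 - p) ^ 2 = 4 * p * x).
{ replace (1 - p) with (2 * u * (v - u)); [rewrite <- eu; unfold p; ring |].
  unfold p; replace 1 with (v * v - u * u) by lra; ring. }
assert (e2 : (1 + p) ^ 2 = 4 * p * (x + 1)) by lra.
assert (hq : Rabs (- p) < 1) by (rewrite Rabs_Ropp, Rabs_pos_eq; lra).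
assert (h := is_RInt_boundary_limit (- p) hq ltac:(lra)).
assert (hf : ex_RInt (fun s => / (x + s) * g s) 0 1).
{ apply ex_RInt_g_mult; intros s hs.
  apply (ex_derive_continuous (V := R_NormedModule)); auto_derive; lra. }
enough (e : RInt (fun s => / (x + s) * g s) 0 1
  = (x + 1) * (exp 1 - Rpower (1 + 1 / x) x) - exp 1 / 2)
  by (rewrite <- e; now apply (RInt_correct (V := R_CompleteNormedModule))).
(* Substitution s = (1 + cos th) / 2; s runs from 1 down to 0, whence the sign. *)
assert (hc : is_RInt (fun th => - (sin th / 2) * (/ (x + (1 + cos th) / 2) * g ((1 + cos th) / 2))) 0 PI
  (- RInt (fun s => / (x + s) * g s) 0 1)).
{ evar_last.
  - apply (is_RInt_comp (V := R_CompleteNormedModule) (fun s => / (x + s) * g s)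
      (fun th => (1 + cos th) / 2) (fun th => - (sin th / 2))); intros th _.
    + destruct (COS_bound th).
      apply (continuous_mult (K := R_AbsRing)); [| apply continuous_g].
      apply (ex_derive_continuous (V := R_NormedModule)); auto_derive; lra.
    + split; [auto_derive; [easy | field] |].
      apply (ex_derive_continuous (V := R_NormedModule)); auto_derive; easy.
  - rewrite cos_0, cos_PI.
    replace ((1 + 1) / 2) with 1 by field; replace ((1 + -1) / 2) with 0 by field.
    symmetry; apply (opp_RInt_swap (V := R_CompleteNormedModule)); easy. }
assert (h2 : is_RInt (fun th => - 4 * PI * g ((1 + cos th) / 2) * sin th / poisson_den (- p) th) 0 PI
  (2 * PI / p * - RInt (fun s => / (x + s) * g s) 0 1)).
{ apply (is_RInt_scal (V := R_NormedModule) _ _ _ (2 * PI / p)) in hc.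
  revert hc; apply (is_RInt_ext (V := R_NormedModule)); intros th _.
  unfold scal; simpl; unfold mult; simpl.
  destruct (COS_bound th).
  replace (poisson_den (- p) th) with (4 * p * (x + (1 + cos th) / 2)).
  - field; lra.
  - unfold poisson_den; generalize e1; nra. }
assert (e := is_RInt_unique _ _ _ _ h); rewrite (is_RInt_unique _ _ _ _ h2) in e; clear h h2 hc.
unfold boundary_value in e.
(* At th = 0 the kernels are (1 - p)^2 = 4 p x and (1 + p)^2 = 4 p (x + 1), so the difference of
   their logarithms is -ln(1 + 1/x). *)
assert (ex : exp ((1 + - p) ^ 2 / - p * artanh_re 0 (1 * - p)) = Rpower (1 + 1 / x) x).
{ unfold Rpower; f_equal; unfold artanh_re, poisson_den; rewrite cos_0.
  replace (1 - 2 * - (1 * - p) * 1 + (- (1 * - p)) ^ 2) with (4 * p * x) by (rewrite <- e1; ring).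
  replace (1 - 2 * (1 * - p) * 1 + (1 * - p) ^ 2) with (4 * p * x * (1 + 1 / x)).
  2:{ transitivity (4 * p * (x + 1)); [field; lra | rewrite <- e2; ring]. }
  assert (0 < 1 / x) by (apply Rdiv_lt_0_compat; lra).
  rewrite (ln_mult (4 * p * x)); [| nra | lra].
  replace (1 + - p) with (1 - p) by ring; rewrite e1; field; lra. }
rewrite ex in e; clear ex.
replace (1 - - p) with (1 + p) in e by ring; rewrite e2 in e.
assert (hpi := PI_RGT_0).
set (I := RInt _ 0 1) in *; set (E := exp 1) in *; set (P := Rpower (1 + 1 / x) x) in *.
assert (e3 : I = - (p / 4) * ((4 * p * (x + 1) * P - E) / p ^ 2 - E)).
{ apply (Rmult_eq_reg_l (2 * PI / p)); [| apply Rgt_not_eq, Rdiv_lt_0_compat; lra].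
  transitivity (- (2 * PI / p * - I)); [ring |]; rewrite e; field; lra. }
change (I = (x + 1) * (E - P) - E / 2 :> R); rewrite e3.
transitivity (- (x + 1) * P + E * (1 + p ^ 2) / (4 * p)); [field; lra |].
replace (1 + p ^ 2) with (4 * p * (x + 1) - 2 * p) by (rewrite <- e2; ring).
field; lra.
Qed.

(** * Comparing power series *)

Definition node (m : nat) : R := / (INR m + 11 / 12).

Lemma node_pos (m : nat) : 0 < node m.
Proof. apply Rinv_0_lt_compat; generalize (pos_INR m); lra. Qed.

Lemma is_lim_seq_node : is_lim_seq (fun m => node (S m)) 0.
Proof.
apply (is_lim_seq_le_le (fun _ => 0) _ (fun m => / INR (S m))).
- intros m; split; [apply Rlt_le, node_pos |].
  apply Rinv_le_contravar; [apply lt_0_INR; lia | lra].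
- apply is_lim_seq_const.
- apply is_lim_seq_INR_S.
Qed.

Lemma coeff_0_of_vanishing (c : nat -> R) :
  (forall m, is_series (fun k => c k * node (S m) ^ k) 0) -> c 0%nat = 0.
Proof.
intros hc.
assert (hP : forall m, PSeries c (node (S m)) = 0)
  by (intros m; unfold PSeries; now apply is_series_unique).
(* Convergence at the single point [node 1] forces a radius of at least [node 1], so the sum is
   continuous at 0 and its value there is the limit along the nodes. *)
assert (hr : Rbar_lt (Rabs 0) (CV_radius c)).
{ apply Rbar_lt_le_trans with (Rabs (node 1)).
  - rewrite Rabs_R0, Rabs_pos_eq by (apply Rlt_le, node_pos); apply node_pos.
  - apply Rbar_not_lt_le; intros h; apply (CV_disk_outside _ _ h).
    apply ex_series_lim_0; eexists; apply (hc 0%nat). }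
assert (hl := is_lim_seq_continuous (PSeries c) _ 0 (PSeries_continuity c 0 hr) is_lim_seq_node).
rewrite PSeries_0 in hl.
assert (e := is_lim_seq_unique _ _ hl).
rewrite (Lim_seq_ext _ (fun _ => 0)) in e by exact hP.
rewrite Lim_seq_const in e; now injection e.
Qed.

(** Once the constant coefficient is known to vanish, dividing by the nonzero node gives the same
    hypothesis for the shifted sequence. *)
Lemma coeff_of_vanishing (c : nat -> R) (k : nat) :
  (forall m, is_series (fun k => c k * node (S m) ^ k) 0) -> c k = 0.
Proof.
revert c; induction k as [| k IH]; intros c hc; [now apply coeff_0_of_vanishing |].
apply (IH (fun k => c (S k))); intros m.
assert (h0 := coeff_0_of_vanishing c hc).
assert (hm := node_pos (S m)).
assert (h1 : is_series (fun k => c (S k) * node (S m) ^ S k) 0).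
{ apply (is_series_incr_1 (fun k => c k * node (S m) ^ k)).
  rewrite h0, Rmult_0_l; unfold plus; simpl; rewrite Rplus_0_l; apply hc. }
apply (is_series_scal (V := R_NormedModule) (/ node (S m))) in h1.
change (is_series (fun k => / node (S m) * (c (S k) * node (S m) ^ S k)) (/ node (S m) * 0)) in h1.
rewrite Rmult_0_r in h1.
revert h1; apply is_series_ext; intros n; simpl; field; lra.
Qed.

Definition moment (j : nat) : R := RInt (fun s => (11 / 12 - s) ^ j * g s) 0 1.

Lemma is_RInt_moment (j : nat) : is_RInt (fun s => (11 / 12 - s) ^ j * g s) 0 1 (moment j).
Proof.
apply (RInt_correct (V := R_CompleteNormedModule)), ex_RInt_g_mult; intros s _.
apply (ex_derive_continuous (V := R_NormedModule)); auto_derive; easy.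
Qed.

Lemma Rabs_g_le (s : R) : 0 <= s <= 1 -> Rabs (g s) <= 1.
Proof.
intros hs.
assert (h : forall s, s <= 1 -> 0 < Rpower s s <= 1).
{ intros x hx; unfold Rpower; split; [apply exp_pos |].
  rewrite <- exp_0; apply exp_le_compat.
  destruct (Rle_dec x 0) as [h0 | h0].
  - unfold ln; destruct (Rlt_dec 0 x); [exfalso; lra | rewrite Rmult_0_r; lra].
  - generalize (ln_nonpos x ltac:(lra)); nra. }
assert (h1 := h s ltac:(lra)); assert (h2 := h (1 - s) ltac:(lra)).
assert (h3 : Rabs (sin (PI * s)) <= 1) by (apply Rabs_le, SIN_bound).
assert (h4 : 0 < 1 / PI <= 1).
{ generalize PI2_1; intros hpi; split; [apply Rdiv_lt_0_compat; lra |].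
  apply Rle_div_l; lra. }
unfold g; rewrite !Rabs_mult.
rewrite (Rabs_pos_eq (1 / PI)), (Rabs_pos_eq (Rpower s s)), (Rabs_pos_eq (Rpower _ _)) by lra.
generalize (Rabs_pos (sin (PI * s))); intros h5.
assert (h6 : 0 <= Rpower s s * Rpower (1 - s) (1 - s) <= 1) by nra.
assert (h7 : 0 <= Rpower s s * Rpower (1 - s) (1 - s) * Rabs (sin (PI * s)) <= 1) by nra.
nra.
Qed.

(** With t = [node m], m + s = 1/t - (11/12 - s), so 1/(m + s) is t times a geometric sum of ratio
    (11/12 - s) t; the finite expansion with its remainder is exact. *)
Lemma is_RInt_geometric_remainder (m n : nat) (l : R) : (1 <= m)%nat ->
  is_RInt (fun s => / (INR m + s) * g s) 0 1 l ->
  is_RInt (fun s => ((11 / 12 - s) * node m) ^ S n / (INR m + s) * g s) 0 1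
    (l - sum_n (fun j => moment j * node m ^ S j) n).
Proof.
intros hm hl.
assert (hm1 : 1 <= INR m) by (change 1 with (INR 1); now apply le_INR).
assert (step : forall n l', is_RInt (fun s => ((11 / 12 - s) * node m) ^ n / (INR m + s) * g s) 0 1 l' ->
  is_RInt (fun s => ((11 / 12 - s) * node m) ^ S n / (INR m + s) * g s) 0 1
    (l' - moment n * node m ^ S n)).
{ intros k l' hl'.
  assert (h := is_RInt_minus (V := R_NormedModule) _ _ _ _ _ _ hl'
    (is_RInt_scal (V := R_NormedModule) _ _ _ (node m ^ S k) _ (is_RInt_moment k))).
  unfold minus, plus, opp, scal in h; simpl in h; unfold mult in h; simpl in h.
  replace (l' - moment k * node m ^ S k) with (l' + - (node m * node m ^ k * moment k))
    by (simpl; ring).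
  revert h; apply (is_RInt_ext (V := R_NormedModule)); intros s hs.
  rewrite Rmin_left, Rmax_right in hs by lra.
  rewrite Rpow_mult_distr; simpl; rewrite Rpow_mult_distr.
  match goal with |- ?a = ?b => change (a = b :> R) end.
  unfold node; field; lra. }
induction n as [| n IH].
- rewrite sum_O; apply step.
  revert hl; apply (is_RInt_ext (V := R_NormedModule)); intros s _.
  simpl; unfold Rdiv; now rewrite Rmult_1_l.
- rewrite sum_Sn.
  replace (l - plus _ _) with (l - sum_n (fun j => moment j * node m ^ S j) n
    - moment (S n) * node m ^ S (S n)) by (unfold plus; simpl; ring).
  now apply step.
Qed.

Lemma is_series_moment (m : nat) (l : R) : (1 <= m)%nat ->
  is_RInt (fun s => / (INR m + s) * g s) 0 1 l ->
  is_series (fun j => moment j * node m ^ S j) l.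
Proof.
intros hm hl.
assert (hm1 : 1 <= INR m) by (change 1 with (INR 1); now apply le_INR).
assert (hn : 0 < node m <= 12 / 23).
{ split; [apply node_pos |]; unfold node.
  replace (12 / 23) with (/ (23 / 12)) by field; apply Rinv_le_contravar; lra. }
change (is_lim_seq (sum_n (fun j => moment j * node m ^ S j)) l).
apply is_lim_seq_ext with (fun n => l - (l - sum_n (fun j => moment j * node m ^ S j) n));
  [intros n; ring |].
replace (Finite l) with (Finite (l - 0)) by (f_equal; ring).
apply is_lim_seq_minus'; [apply is_lim_seq_const |].
apply is_lim_seq_abs_0.
(* For m >= 1 the ratio (11/12 - s) t is at most (11/12)(12/23) = 11/23 in absolute value, below
   1/2. *)
apply (is_lim_seq_le_le (fun _ => 0) _ (fun n => (1 / 2) ^ S n)).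
- intros n; split; [apply Rabs_pos |].
  assert (h := is_RInt_geometric_remainder m n l hm hl).
  rewrite <- (is_RInt_unique _ _ _ _ h).
  replace ((1 / 2) ^ S n) with ((1 - 0) * (1 / 2) ^ S n) by ring.
  apply abs_RInt_le_const; [lra | now eexists; apply h |].
  intros s hs; rewrite Rabs_mult.
  rewrite <- (Rmult_1_r ((1 / 2) ^ S n)).
  apply Rmult_le_compat; try apply Rabs_pos; [| now apply Rabs_g_le].
  unfold Rdiv at 1; rewrite Rabs_mult, <- RPow_abs, (Rabs_pos_eq (/ _))
    by (apply Rlt_le, Rinv_0_lt_compat; lra).
  rewrite <- (Rmult_1_r ((1 / 2) ^ S n)).
  apply Rmult_le_compat.
  + apply pow_le, Rabs_pos.
  + apply Rlt_le, Rinv_0_lt_compat; lra.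
  + apply pow_incr; split; [apply Rabs_pos |]; apply Rabs_le; nra.
  + rewrite <- Rinv_1; apply Rinv_le_contravar; lra.
- apply is_lim_seq_const.
- apply (is_lim_seq_incr (fun n => (1 / 2) ^ n)), is_lim_seq_geom.
  rewrite Rabs_pos_eq; lra.
Qed.

(** Let D be the sum of d_k t^k. As x + 1 = 1/t + 1/12, these are the coefficients in t of D/t +
    D/12 - 1/2 minus 1/e times the moment series, which the Stieltjes representation makes 0 at
    every node. *)
Definition defect (d : nat -> R) (k : nat) : R :=
  match k with
  | O => d 1%nat - 1 / 2
  | S j => d (S (S j)) + d (S j) / 12 - moment j / exp 1
  end.

Lemma is_series_defect (d : nat -> R) (m : nat) : expansion_coefficients d ->
  is_series (fun k => defect d k * node (S m) ^ k) 0.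
Proof.
intros hd; destruct (hd (S m) ltac:(lia)) as [hs he].
set (x := INR (S m)) in *; set (t := node (S m)).
assert (hx : 1 <= x) by (change 1 with (INR 1); apply le_INR; lia).
assert (ht : 0 < t) by apply node_pos.
assert (etx : x = / t - 11 / 12) by (unfold t, node; fold x; field; lra).
set (D := Series (expansion_term d (S m))) in *.
assert (hD : is_series (expansion_term d (S m)) D) by now apply Series_correct.
set (Q := (x + 1) * (exp 1 - Rpower (1 + 1 / x) x) - exp 1 / 2).
assert (hQ : is_series (fun j => moment j * t ^ S j) Q).
{ apply is_series_moment; [lia |]; apply is_RInt_stieltjes; fold x; lra. }
assert (eQ : Q = exp 1 * ((x + 1) * D - 1 / 2)).
{ unfold Q; replace (Rpower (1 + 1 / x) x) with ((1 + 1 / x) ^ S m).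
  - rewrite he; field.
  - unfold x at 3; rewrite Rpower_pow; [easy |].
    assert (0 < 1 / x) by (apply Rdiv_lt_0_compat; lra); lra. }
assert (hE : 0 < exp 1) by apply exp_pos.
assert (hD' : is_series (fun k => d (S k) * t ^ S k) D).
{ revert hD; apply is_series_ext; intros k.
  unfold expansion_term, t, node; fold x; rewrite pow_inv; reflexivity. }
assert (h1 : is_series (fun k => d (S k) * t ^ k) (D / t)).
{ apply (is_series_scal (V := R_NormedModule) (/ t)) in hD'.
  replace (D / t) with (scal (/ t) D) by (unfold scal; simpl; unfold mult; simpl; unfold Rdiv; ring).
  revert hD'; apply is_series_ext; intros k.
  unfold scal; simpl; unfold mult; simpl; field; lra. }
apply is_series_decr_1.
assert (h2 : is_series (fun k => d (S (S k)) * t ^ S k) (D / t - d 1%nat)).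
{ apply (is_series_incr_1 (fun k => d (S k) * t ^ k)).
  replace (plus _ _) with (D / t); [easy |].
  unfold plus; simpl; ring. }
assert (h3 := is_series_minus (V := R_NormedModule) _ _ _ _
  (is_series_plus (V := R_NormedModule) _ _ _ _ h2
     (is_series_scal (V := R_NormedModule) (1 / 12) _ _ hD'))
  (is_series_scal (V := R_NormedModule) (/ exp 1) _ _ hQ)).
match type of h3 with is_series _ ?a =>
  replace a with (plus 0 (opp (defect d 0 * t ^ 0))) in h3 end.
- revert h3; apply is_series_ext; intros k.
  unfold minus, plus, opp, scal, defect; simpl; unfold mult; simpl; field; lra.
- rewrite eQ, etx; unfold minus, plus, opp, scal, defect; simpl; unfold mult; simpl.
  field; lra.
Qed.

(** Put u = 12 s - 11. Because u - 1 = 12 (s - 1), passing from n to n + 1 adds 12 u^n to the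
    quotient, and u = -12 (11/12 - s) turns this into 12 (-12)^n times a moment integrand. The
    vanishing defect supplies the moment, and d_1 = 1/2 starts the induction. *)
Lemma is_RInt_coefficient (d : nat -> R) (n : nat) : expansion_coefficients d ->
  is_RInt (fun s => ((12 * s - 11) ^ n - 1) / (s - 1) * g s) 0 1
    (exp 1 * (1 / 2 - (-12) ^ n * d (S n))).
Proof.
intros hd.
assert (hc : forall k, defect d k = 0)
  by (intros k; apply coeff_of_vanishing; intros m; now apply is_series_defect).
induction n as [| n IH].
- generalize (hc 0%nat); simpl; intros h0.
  replace (exp 1 * (1 / 2 - 1 * d 1%nat)) with (scal (1 - 0) 0)
    by (unfold scal; simpl; unfold mult; simpl; replace (d 1%nat) with (1 / 2) by lra; ring).
  apply (is_RInt_ext (V := R_NormedModule) (fun _ => 0)).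
  + intros s _; unfold Rdiv; simpl; ring.
  + apply (is_RInt_const (V := R_NormedModule)).
- generalize (hc (S n)); simpl defect; intros h1.
  assert (hE : 0 < exp 1) by apply exp_pos.
  assert (h := is_RInt_plus (V := R_NormedModule) _ _ _ _ _ _ IH
    (is_RInt_scal (V := R_NormedModule) _ _ _ (12 * (-12) ^ n) _ (is_RInt_moment n))).
  match type of h with is_RInt _ _ _ ?a =>
    replace a with (exp 1 * (1 / 2 - (-12) ^ S n * d (S (S n)))) in h end.
  + revert h; apply (is_RInt_ext (V := R_NormedModule)); intros s hs.
    rewrite Rmin_left, Rmax_right in hs by lra.
    unfold plus, scal; simpl; unfold mult; simpl.
    replace (12 * s - 11) with ((-12) * (11 / 12 - s)) by field.
    rewrite Rpow_mult_distr.
    match goal with |- ?a = ?b => change (a = b :> R) end.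
    field; lra.
  + replace (moment n) with (exp 1 * (d (S (S n)) + d (S n) / 12)).
    * unfold plus, scal; simpl; unfold mult; simpl; field.
    * replace (d (S (S n)) + d (S n) / 12) with (moment n / exp 1) by lra; field; lra.
Qed.

Theorem theorem3 (d : nat -> R) (hd : expansion_coefficients d)
    (n : nat) (hn : (2 <= n)%nat) :
  ex_RInt (fun s : R => ((12 * s - 11) ^ (n - 1) - 1) / (s - 1) * g s) 0 1 /\
  d n = (-1) ^ n / 12 ^ (n - 1) *
        (- (1 / 2) + 1 / exp 1 *
           RInt (fun s : R => ((12 * s - 11) ^ (n - 1) - 1) / (s - 1) * g s) 0 1).
Proof.
assert (h := is_RInt_coefficient d (n - 1) hd).
split; [now eexists; apply h |].
rewrite (is_RInt_unique _ _ _ _ h).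
replace (S (n - 1)) with n by lia.
assert (hE : 0 < exp 1) by apply exp_pos.
assert (e1 : (-1) ^ n = - (-1) ^ (n - 1)).
{ replace n with (S (n - 1)) at 1 by lia; simpl; ring. }
assert (e2 : (-12) ^ (n - 1) = (-1) ^ (n - 1) * 12 ^ (n - 1))
  by (rewrite <- Rpow_mult_distr; f_equal; ring).
assert (e3 : (-1) ^ (n - 1) * (-1) ^ (n - 1) = 1).
{ rewrite <- Rpow_mult_distr; replace (-1 * -1) with 1 by ring; apply pow1. }
assert (h12 : 12 ^ (n - 1) <> 0) by (apply pow_nonzero; lra).
rewrite e1, e2; transitivity ((-1) ^ (n - 1) * (-1) ^ (n - 1) * d n); [rewrite e3; ring | field; lra].
Qed.
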